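(* Let $\sigma$ be the reduction sequence $M=M_1\to^{R_1}M_2\to^{R_2}\cdots\to^{R_n}M_{n+1}$. Then there is a standard reduction sequence $st(\sigma)$ from $M_1$ to $M_{n+1}$ such that $|st(\sigma)|\le\mathcal M(\sigma)$. Moreover, if $M$ is a $\lambda\mu I$-term, then $|\sigma|\le|st(\sigma)|$ also holds.
   Context: Terms are generated from $\lambda$-variables $x,y,\dots$ and $\mu$-variables $\alpha,\beta,\dots$ by $\mathcal T::=x\mid \lambda x.\mathcal T\mid\mu\alpha.\mathcal T\mid[\alpha]\mathcal T\mid(\mathcal T\,\mathcal T)$, modulo renaming of bound variables; application associates to the left. $comp(x)=1$, $comp([\alpha]M)=comp(\lambda x.M)=comp(\mu\alpha.M)=comp(M)+1$, $comp(M\,N)=comp(M)+comp(N)$. $|M|_\alpha$ is the number of (free) occurrences of $\alpha$ in $M$. Types: built from atomic types and $\bot$ with $\to$; $\neg A$ is $A\to\bot$. Typing: $\Gamma,x:A\vdash x:A$; $\Gamma,x:A\vdash M:B$ gives $\Gamma\vdash\lambda x.M:A\to B$; $\Gamma\vdash M:A\to B$, $\Gamma\vdash N:A$ give $\Gamma\vdash M\,N:B$; $\Gamma,\alpha:\neg A\vdash M:A$ gives $\Gamma,\alpha:\neg A\vdash[\alpha]M:\bot$; $\Gamma,\alpha:\neg A\vdash M:\bot$ gives $\Gamma\vdash\mu\alpha.M:A$. All terms considered are typable. Reduction rules: $(\lambda x.M)N\to_\beta M[x:=N]$; $(\mu\alpha.M)N\to_\mu\mu\alpha.M[\alpha:=_rN]$,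 where $[\alpha:=_rN]$ (recursively) replaces each subterm $[\alpha]U$ ($\alpha$ free) by $[\alpha](U\,N)$; $[\alpha]\mu\beta.M\to_\rho M[\beta:=\alpha]$; $\mu\alpha.[\alpha]M\to_\theta M$ if $\alpha\notin Fv(M)$. $M\to^RN$: $N$ results from contracting the redex occurrence $R$ in $M$. $M\mapsto^\sigma N$: $\sigma=[R_1,\dots,R_n]$ is a reduction sequence from $M$ to $N$, $|\sigma|=n$; $\#$ is concatenation. $\lambda\mu I$-terms: variables; $(M\,N)$ and $[\alpha]M$ for $\lambda\mu I$-terms $M,N$; $\lambda x.M$ for a $\lambda\mu I$-term $M$ with $x\in Fv(M)$; $\mu\alpha.M$ for a $\lambda\mu I$-term $M$ with $\alpha\in Fv(M)$. Standard sequences (recursion on $(|\sigma|,comp(M))$, lexicographically). $M\mapsto^\sigma N$ is standard if it is empty or one of the following holds. (1) $M=\lambda x.M_1$, $N=\lambda x.N_1$, $M_1\mapsto^\sigma N_1$ is standard. (2) $M=\mu\alpha.M_1$, with $\sigma$ being $M=P_1\to\cdots\to P_{k+1}=N$, and either (a) $N=\mu\alpha.N_1$, $M_1\mapsto^\sigma N_1$ is standard and no $P_j$ is a $\theta$-redex; or (b) $P_j=\mu\alpha.[\alpha]M'$ is the first $P_j$ that is a $\theta$-redex, the initial part $\sigma'$ of $\sigma$ up to $P_j$ is standard (as a sequence $M_1\mapsto^{\sigma'}[\alpha]M'$), and the rest is either (i) $P_j\to_\theta M'\mapsto^{\sigma''}N$ with $\sigma''$ standard, or (ii) $P_j\mapsto^{\sigma'''}\mu\alpha.[\alpha]N'=N$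 with $M'\mapsto^{\sigma'''}N'$ standard. (3) $M=[\alpha]M_1$, with $\sigma$ being $M=P_1\to\cdots\to P_{k+1}=N$, and either (a) $N=[\alpha]N_1$, $M_1\mapsto^\sigma N_1$ is standard and no $P_j$ is a $\rho$-redex; or (b) $P_j=[\alpha]\mu\beta.M'$ is the first $P_j$ that is a $\rho$-redex, the initial part $\sigma'$ of $\sigma$ up to $P_j$ is standard (as a sequence $M_1\mapsto^{\sigma'}\mu\beta.M'$), and the rest is either (i) $P_j\to_\rho M'[\beta:=\alpha]\mapsto^{\sigma''}N$ with $\sigma''$ standard, or (ii) $P_j\mapsto^{\sigma'''}[\alpha]\mu\beta.N'=N$ with $M'\mapsto^{\sigma'''}N'$ standard. (4) $M=(\lambda x.M_1)M_2\dots M_n$ ($n\ge2$) and either (a) $M\to_\beta(M_1[x:=M_2]\,M_3\dots M_n)\mapsto^{\sigma_1}N$ with $\sigma_1$ standard, or (b) $N=(\lambda x.N_1)N_2\dots N_n$ and $\sigma=\sigma_1\#\cdots\#\sigma_n$ with $\lambda x.M_1\mapsto^{\sigma_1}\lambda x.N_1$ and $M_i\mapsto^{\sigma_i}N_i$ ($i\ge2$) standard. (5) $M=(\mu\alpha.M_1)M_2\dots M_n$ ($n\ge2$) and either (a) $M\to_\mu(\mu\alpha.M_1[\alpha:=_rM_2])M_3\dots M_n\mapsto^{\sigma_1}N$ with $\sigma_1$ standard, or (b) $N=(\mu\alpha.N_1)N_2\dots N_n$ and $\sigma=\sigma_1\#\cdots\#\sigma_n$ with $\mu\alpha.M_1\mapsto^{\sigma_1}\mu\alpha.N_1$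 (the prefix $\mu\alpha$ being kept, i.e. never contracted as a $\theta$-redex) and $M_i\mapsto^{\sigma_i}N_i$ ($i\ge2$) standard. (6) $M=(x\,M_1\dots M_n)$, $N=(x\,N_1\dots N_n)$, $\sigma=\sigma_1\#\cdots\#\sigma_n$ with $M_i\mapsto^{\sigma_i}N_i$ standard. For a redex $R$ in $M$: $m(R,M)=|P|_\alpha$ if $R=(\mu\alpha.P)Q$; $m(R,M)=2\,comp(M)-2$ if $R=(\lambda x.P)Q$; $m(R,M)=1$ if $R=[\alpha]\mu\beta.P$; $m(R,M)=2n-1$ if $R=\mu\alpha.[\alpha]P$ is a $\theta$-redex having $n$ arguments in $M$ (i.e. it occurs as $(R\,P_1\dots P_n)$ with $n$ maximal). Measure: $\mathcal M(\sigma)=\prod_{i=1}^n\bigl(1+\max(m(R_i,M_i),2)\bigr)$.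
   Formalization: In clause (5)(b) the kept prefix μα is inert: M₁ ↦ N₁ is required to be standard in the body, without clause (2)'s θ-restrictions. Read literally, the claim fails for the ρ-step (μα.[α]μβ.z)y₁y₂y₃ → (μα.z)y₁y₂y₃ (measure 3, the standard sequence has length 4). *)

(* Defs.v *)
From Stdlib Require Export List Arith.
Export ListNotations.

(** Terms modulo renaming, in de Bruijn form with two independent families of
    indices: [Var] points to [Lam] binders, [Name] points to [Mu] binders. *)
Inductive term : Type :=
| Var (x : nat)
| Lam (M : term)
| Mu (M : term)
| Name (a : nat) (M : term)
| App (M N : term).

(** [apps M [N1; ...; Nn]] is [M N1 ... Nn]. *)
Definition apps (M : term) (Ns : list term) : term := fold_left App Ns M.

Fixpoint comp (M : term) : nat :=
  match M with
  | Var _ => 1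
  | Lam M | Mu M | Name _ M => comp M + 1
  | App M N => comp M + comp N
  end.

(** Number of free occurrences of a variable; a variable is in [Fv] when this
    number is positive. *)
Fixpoint locc (x : nat) (M : term) : nat :=
  match M with
  | Var y => if x =? y then 1 else 0
  | Lam M => locc (S x) M
  | Mu M | Name _ M => locc x M
  | App M N => locc x M + locc x N
  end.

Fixpoint mocc (a : nat) (M : term) : nat :=
  match M with
  | Var _ => 0
  | Lam M => mocc a M
  | Mu M => mocc (S a) M
  | Name b M => (if a =? b then 1 else 0) + mocc a M
  | App M N => mocc a M + mocc a N
  end.

Definition upren (r : nat -> nat) (n : nat) : nat :=
  match n with 0 => 0 | S n => S (r n) end.

Fixpoint lren (r : nat -> nat) (M : term) : term :=
  match M with
  | Var x => Var (r x)
  | Lam M => Lam (lren (upren r) M)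
  | Mu M => Mu (lren r M)
  | Name a M => Name a (lren r M)
  | App M N => App (lren r M) (lren r N)
  end.

Fixpoint mren (r : nat -> nat) (M : term) : term :=
  match M with
  | Var x => Var x
  | Lam M => Lam (mren r M)
  | Mu M => Mu (mren (upren r) M)
  | Name a M => Name (r a) (mren r M)
  | App M N => App (mren r M) (mren r N)
  end.

Definition upsub (s : nat -> term) (n : nat) : term :=
  match n with 0 => Var 0 | S n => lren S (s n) end.

Fixpoint lsub (s : nat -> term) (M : term) : term :=
  match M with
  | Var x => s x
  | Lam M => Lam (lsub (upsub s) M)
  | Mu M => Mu (lsub (fun n => mren S (s n)) M)
  | Name a M => Name a (lsub s M)
  | App M N => App (lsub s M) (lsub s N)
  end.

(** [M[x := N]] for the variable bound just outside [M]. *)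
Definition beta_subst (M N : term) : term :=
  lsub (fun n => match n with 0 => N | S n => Var n end) M.

(** [M[a :=_r N]], with [N] in the same scope as [M]; [a] remains in scope. *)
Fixpoint rsub (a : nat) (N : term) (M : term) : term :=
  match M with
  | Var x => Var x
  | Lam M => Lam (rsub a (lren S N) M)
  | Mu M => Mu (rsub (S a) (mren S N) M)
  | Name b M =>
      if b =? a then Name b (App (rsub a N M) N) else Name b (rsub a N M)
  | App M M' => App (rsub a N M) (rsub a N M')
  end.

(** [M[b := a]] for the mu-variable [b] bound just outside [M]. *)
Definition rho_subst (M : term) (a : nat) : term :=
  mren (fun n => match n with 0 => a | S n => n end) M.

(** Removes an unused mu-variable [0] from the scope. *)
Definition mlower (M : term) : term := mren pred M.

Definition theta_redex (M : term) : Prop :=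
  exists P, M = Mu (Name 0 P) /\ mocc 0 P = 0.

Definition rho_redex (M : term) : Prop :=
  exists a P, M = Name a (Mu P).

(** Redex occurrences are positions: the root constructors of a redex determine
    its kind, so a position determines the contraction performed there. *)
Inductive dir : Type := Body | Fun | Arg.
Definition pos : Type := list dir.

Fixpoint subterm (p : pos) (M : term) : option term :=
  match p, M with
  | [], _ => Some M
  | Body :: p, (Lam M | Mu M | Name _ M) => subterm p M
  | Fun :: p, App M _ => subterm p M
  | Arg :: p, App _ N => subterm p N
  | _, _ => None
  end.

Definition contract_root (M : term) : option term :=
  match M with
  | App (Lam P) Q => Some (beta_subst P Q)
  | App (Mu P) Q => Some (Mu (rsub 0 (mren S Q) P))
  | Name a (Mu P) => Some (rho_subst P a)
  | Mu (Name 0 P) => if mocc 0 P =? 0 then Some (mlower P) else None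
  | _ => None
  end.

Fixpoint contract (p : pos) (M : term) : option term :=
  match p, M with
  | [], _ => contract_root M
  | Body :: p, Lam M => option_map Lam (contract p M)
  | Body :: p, Mu M => option_map Mu (contract p M)
  | Body :: p, Name a M => option_map (Name a) (contract p M)
  | Fun :: p, App M N => option_map (fun M' => App M' N) (contract p M)
  | Arg :: p, App M N => option_map (App M) (contract p N)
  | _, _ => None
  end.

(** [reduces M s N]: the sequence [s] of redex occurrences, each read in the
    term obtained so far, leads from [M] to [N]. *)
Inductive reduces : term -> list pos -> term -> Prop :=
| red_nil M : reduces M [] M
| red_cons M p M' s N :
    contract p M = Some M' -> reduces M' s N -> reduces M (p :: s) N.

Inductive ty : Type :=
| Atom (n : nat)
| Bot
| Arrow (A B : ty).

(** An entry [A] of [D] stands for the declaration of a mu-variable of type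
    [Arrow A Bot]. *)
Inductive typing : list ty -> list ty -> term -> ty -> Prop :=
| ty_var G D x A : nth_error G x = Some A -> typing G D (Var x) A
| ty_lam G D M A B : typing (A :: G) D M B -> typing G D (Lam M) (Arrow A B)
| ty_app G D M N A B :
    typing G D M (Arrow A B) -> typing G D N A -> typing G D (App M N) B
| ty_name G D a M A :
    nth_error D a = Some A -> typing G D M A -> typing G D (Name a M) Bot
| ty_mu G D M A : typing G (A :: D) M Bot -> typing G D (Mu M) A.

Definition typable (M : term) : Prop := exists G D A, typing G D M A.

Inductive lambda_mu_I : term -> Prop :=
| lmI_var x : lambda_mu_I (Var x)
| lmI_app M N : lambda_mu_I M -> lambda_mu_I N -> lambda_mu_I (App M N)
| lmI_name a M : lambda_mu_I M -> lambda_mu_I (Name a M)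
| lmI_lam M : lambda_mu_I M -> 0 < locc 0 M -> lambda_mu_I (Lam M)
| lmI_mu M : lambda_mu_I M -> 0 < mocc 0 M -> lambda_mu_I (Mu M).

(** [at_ q s]: the sequence [s] performed inside the subterm at position [q]. *)
Definition at_ (q : pos) (s : list pos) : list pos := map (app q) s.

(** No term of the sequence [s] starting from [M], resp. no term of it except
    possibly the last one, satisfies [bad]. *)
Definition never (bad : term -> Prop) (M : term) (s : list pos) : Prop :=
  forall s1 s2 P, s = s1 ++ s2 -> reduces M s1 P -> ~ bad P.

Definition never_before_end
    (bad : term -> Prop) (M : term) (s : list pos) : Prop :=
  forall s1 p s2 P, s = s1 ++ p :: s2 -> reduces M s1 P -> ~ bad P.

(** The recursion on (length, [comp]) is well founded, so the inductive reading
    of the clauses defines the same notion.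

    In [standard_mu_args] the prefix [Mu] is kept, i.e. it is never contracted as
    a theta-redex.  It then plays the same role as the prefix [Lam] in
    [standard_lam_args], and the sequence is standard when it is so in the body:
    the theta clauses of the case [Mu M1] do not apply to a kept prefix.  Imposing
    the restriction of [standard_mu_theta_in] there would leave some reductions
    without a short standard counterpart, e.g. the single rho-step
    [(mu a.[a]mu b.z) y1 y2 y3 -> (mu a.z) y1 y2 y3]. *)
Inductive standard : term -> list pos -> term -> Prop :=
| standard_nil M : standard M [] M
| standard_lam M1 s N1 :
    standard M1 s N1 ->
    standard (Lam M1) (at_ [Body] s) (Lam N1)
| standard_mu M1 s N1 :
    standard M1 s N1 ->
    never theta_redex (Mu M1) (at_ [Body] s) ->
    standard (Mu M1) (at_ [Body] s) (Mu N1)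
| standard_mu_theta M1 s1 P s2 N :
    standard M1 s1 (Name 0 P) ->
    mocc 0 P = 0 ->
    never_before_end theta_redex (Mu M1) (at_ [Body] s1) ->
    standard (mlower P) s2 N ->
    standard (Mu M1) (at_ [Body] s1 ++ [] :: s2) N
| standard_mu_theta_in M1 s1 P s2 Q :
    standard M1 s1 (Name 0 P) ->
    mocc 0 P = 0 ->
    never_before_end theta_redex (Mu M1) (at_ [Body] s1) ->
    standard P s2 Q ->
    standard (Mu M1) (at_ [Body] s1 ++ at_ [Body; Body] s2) (Mu (Name 0 Q))
| standard_name a M1 s N1 :
    standard M1 s N1 ->
    never rho_redex (Name a M1) (at_ [Body] s) ->
    standard (Name a M1) (at_ [Body] s) (Name a N1)
| standard_name_rho a M1 s1 P s2 N :
    standard M1 s1 (Mu P) ->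
    never_before_end rho_redex (Name a M1) (at_ [Body] s1) ->
    standard (rho_subst P a) s2 N ->
    standard (Name a M1) (at_ [Body] s1 ++ [] :: s2) N
| standard_name_rho_in a M1 s1 P s2 Q :
    standard M1 s1 (Mu P) ->
    never_before_end rho_redex (Name a M1) (at_ [Body] s1) ->
    standard P s2 Q ->
    standard (Name a M1) (at_ [Body] s1 ++ at_ [Body; Body] s2) (Name a (Mu Q))
| standard_beta M1 M2 Ms s N :
    standard (apps (beta_subst M1 M2) Ms) s N ->
    standard (apps (Lam M1) (M2 :: Ms)) (repeat Fun (length Ms) :: s) N
| standard_lam_args M1 Ms s1 N1 s Ns :
    Ms <> [] ->
    standard (Lam M1) s1 (Lam N1) ->
    standard_args Ms s Ns ->
    standard (apps (Lam M1) Ms)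
      (at_ (repeat Fun (length Ms)) s1 ++ s) (apps (Lam N1) Ns)
| standard_mu_app M1 M2 Ms s N :
    standard (apps (Mu (rsub 0 (mren S M2) M1)) Ms) s N ->
    standard (apps (Mu M1) (M2 :: Ms)) (repeat Fun (length Ms) :: s) N
| standard_mu_args M1 Ms s1 N1 s Ns :
    Ms <> [] ->
    standard M1 s1 N1 ->
    standard_args Ms s Ns ->
    standard (apps (Mu M1) Ms)
      (at_ (repeat Fun (length Ms) ++ [Body]) s1 ++ s) (apps (Mu N1) Ns)
| standard_var_args x Ms s Ns :
    standard_args Ms s Ns ->
    standard (apps (Var x) Ms) s (apps (Var x) Ns)

(** [standard_args Ms s Ns]: [s] consists of standard sequences from the terms of
    [Ms] to those of [Ns], from left to right, where [Ms] is the list of the last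
    arguments of the term in which [s] takes place. *)
with standard_args : list term -> list pos -> list term -> Prop :=
| standard_args_nil : standard_args [] [] []
| standard_args_cons M Ms s1 N s Ns :
    standard M s1 N ->
    standard_args Ms s Ns ->
    standard_args (M :: Ms) (at_ (repeat Fun (length Ms) ++ [Arg]) s1 ++ s)
      (N :: Ns).

(** Number of arguments of the subterm at [p]: length of the final block of
    [Fun]s in [p]. *)
Definition nargs (p : pos) : nat :=
  fold_left (fun n d => match d with Fun => S n | _ => 0 end) p 0.

(** The weight [m(R, M)] of the redex [R] at [p] in [M].  For a theta-redex
    without arguments, [2n - 1] is [-1], truncated to [0] here; [measure] only
    uses the maximum of the weight and [2]. *)
Definition weight (p : pos) (M : term) : nat :=
  match subterm p M with
  | Some (App (Mu P) _) => mocc 0 P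
  | Some (App (Lam _) _) => 2 * comp M - 2
  | Some (Name _ (Mu _)) => 1
  | Some (Mu (Name 0 _)) => 2 * nargs p - 1
  | _ => 0
  end.

Fixpoint measure (M : term) (s : list pos) : nat :=
  match s with
  | [] => 1
  | p :: s =>
      (1 + max (weight p M) 2) *
      match contract p M with
      | Some M' => measure M' s
      | None => 1
      end
  end.

(* Main.v *)
Require Import Defs.
From Stdlib Require Import Lia FunctionalExtensionality.

(** Standard sequences are not closed under the operations of the argument: once a
    theta-redex has appeared, the clause [standard_mu_theta_in] starts afresh below
    it, and the outcome need not remain standard in another context.  The proof
    therefore uses a more restrictive relation [std M n N], in which contracting
    [mu a.[a]P] by theta, or [[a]mu b.V] by rho, is the last thing to happen at
    that place.  It is compatible with all term constructors, at a controlled cost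
    for application: an argument list of length [j] multiplies the length by at
    most [j + 1], as each rho- or theta-step must be preceded by [j] mu-steps that
    absorb the arguments.

    Appending a step [R] to [std M n N] gives [std M n' N'] with
    [n' + 1 <= (1 + max (m(R), 2)) * (n + 1)], hence the product bound by
    induction; for typable lambda-mu-I-terms moreover [n + 1 <= n'].

    Conversely, [std M n N] is realised by a standard sequence of length [n]: if
    the body of a [mu] (or of a naming) becomes a theta-redex (rho-redex) before
    the sequence ends, it is cut at the first such place, and what remains is
    again in [std] and is realised by induction on the length and the size. *)

(** * Substitution calculus *)

(** Application and substitution depend on each other: substituting for a head variable requires
    reducing an applied term, while steps inside an applied term require handing its arguments to
    bound names, again a substitution. One lemma therefore treats substitutions that only rename
    variables, or any substitution once the application bound is given; its identity instance yields
    that bound. Once a theta- or rho-redex has appeared, a standard sequence may only contract it or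
    work below it, whereas [std] may still do rho under the theta-redex, or theta under the naming.
    On the overlaps [mu a.[a]mu b.V] and [[a]mu b.[b]P] both contractions give the same term, so one
    is exchanged for the other at equal length. A cut needs a standard prefix and a suffix in [std]
    to be realised anew, which is why all prefixes and suffixes are controlled. The lower bound
    requires that no reduction of an argument is erased, hence that the function reached is still a
    lambda-mu-I-term. An actual reduction is needed to transport this property, so appending a step
    comes after realisation. *)

Definition scons {T : Type} (h : T) (f : nat -> T) (n : nat) : T :=
  match n with 0 => h | S n => f n end.

Fixpoint rn (p q : nat -> nat) (M : term) : term :=
  match M with
  | Var x => Var (p x)
  | Lam M => Lam (rn (upren p) q M)
  | Mu M => Mu (rn p (upren q) M)
  | Name a M => Name (q a) (rn p q M)
  | App M N => App (rn p q M) (rn p q N)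
  end.

(** Subsumes [lren], [mren], [lsub] and [rsub], and is closed under composition:
    [r a] lists the arguments that [:=_r] gives to the subterms named [a]. *)
Fixpoint fsub (s : nat -> term) (q : nat -> nat) (r : nat -> list term)
    (M : term) : term :=
  match M with
  | Var x => s x
  | Lam M => Lam (fsub (upsub s) q (fun a => map (lren S) (r a)) M)
  | Mu M =>
      Mu (fsub (fun x => mren S (s x)) (upren q)
            (scons [] (fun a => map (mren S) (r a))) M)
  | Name a M => Name (q a) (apps (fsub s q r M) (r a))
  | App M N => App (fsub s q r M) (fsub s q r N)
  end.

Definition no_args : nat -> list term := fun _ => [].
Definition ident : nat -> nat := fun n => n.

Lemma upren_id : upren ident = ident.
Proof. extensionality n; now destruct n. Qed.

Lemma upren_comp p p' : (fun n => upren p (upren p' n)) = upren (fun n => p (p' n)).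
Proof. extensionality n; now destruct n. Qed.

Lemma lren_rn p M : lren p M = rn p ident M.
Proof.
  revert p; induction M; intros p; simpl; rewrite ?upren_id; f_equal; auto.
Qed.

Lemma mren_rn q M : mren q M = rn ident q M.
Proof.
  revert q; induction M; intros q; simpl; rewrite ?upren_id; f_equal; auto.
Qed.

Lemma rn_rn p q p' q' M :
  rn p q (rn p' q' M) = rn (fun n => p (p' n)) (fun n => q (q' n)) M.
Proof.
  revert p q p' q'; induction M; intros p q p' q'; simpl; f_equal; auto;
    rewrite IHM, ?upren_comp; reflexivity.
Qed.

Lemma apps_app M Ns Ns' : apps M (Ns ++ Ns') = apps (apps M Ns) Ns'.
Proof. apply fold_left_app. Qed.

Lemma rn_apps p q M Ns : rn p q (apps M Ns) = apps (rn p q M) (map (rn p q) Ns).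
Proof. revert M; induction Ns; intros M; simpl; [easy | apply IHNs]. Qed.

Lemma fsub_apps s q r M Ns :
  fsub s q r (apps M Ns) = apps (fsub s q r M) (map (fsub s q r) Ns).
Proof. revert M; induction Ns; intros M; simpl; [easy | apply IHNs]. Qed.

Lemma fsub_rn s q r p' q' M :
  fsub s q r (rn p' q' M)
  = fsub (fun x => s (p' x)) (fun a => q (q' a)) (fun a => r (q' a)) M.
Proof.
  revert s q r p' q'; induction M; intros s q r p' q'; simpl; f_equal; auto.
  - rewrite IHM; f_equal; extensionality n; now destruct n.
  - rewrite IHM; f_equal; extensionality n; now destruct n.
  - now rewrite IHM.
Qed.

Lemma map_map_ext {T U V W : Type} (f : U -> V) (g : T -> U) (h : W -> V) (k : T -> W) l :
  (forall x, f (g x) = h (k x)) -> map f (map g l) = map h (map k l).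
Proof. intros E; rewrite !map_map; now apply map_ext. Qed.

Lemma rn_fsub p q s q' r M :
  rn p q (fsub s q' r M)
  = fsub (fun x => rn p q (s x)) (fun a => q (q' a))
      (fun a => map (rn p q) (r a)) M.
Proof.
  revert p q s q' r; induction M; intros p q s q' r; simpl; f_equal; auto.
  - rewrite IHM; f_equal.
    + extensionality n; destruct n as [|n]; simpl; [easy|].
      rewrite !lren_rn, !rn_rn; reflexivity.
    + extensionality a; apply map_map_ext; intros x.
      rewrite !lren_rn, !rn_rn; reflexivity.
  - rewrite IHM; f_equal.
    + extensionality n; rewrite !mren_rn, !rn_rn; reflexivity.
    + now rewrite upren_comp.
    + extensionality a; destruct a as [|a]; simpl; [easy|].
      apply map_map_ext; intros x; rewrite !mren_rn, !rn_rn; reflexivity.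
  - rewrite rn_apps; now rewrite IHM.
Qed.

(** The arguments given by the inner substitution come first, as they stand nearest to the named
    subterm. *)
Lemma fsub_fsub s q r s' q' r' M :
  fsub s q r (fsub s' q' r' M)
  = fsub (fun x => fsub s q r (s' x)) (fun a => q (q' a))
      (fun a => map (fsub s q r) (r' a) ++ r (q' a)) M.
Proof.
  revert s q r s' q' r'; induction M; intros s q r s' q' r'; simpl; f_equal; auto.
  - rewrite IHM; f_equal.
    + extensionality n; destruct n as [|n]; simpl; [easy|].
      rewrite !lren_rn, fsub_rn, rn_fsub; f_equal.
      * extensionality x; apply lren_rn.
      * extensionality a; apply map_ext; intros; apply lren_rn.
    + extensionality a; rewrite map_app; f_equal.
      apply map_map_ext; intros x; rewrite !lren_rn, fsub_rn, rn_fsub; f_equal.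
      * extensionality y; apply lren_rn.
      * extensionality b; apply map_ext; intros; apply lren_rn.
  - rewrite IHM; f_equal.
    + extensionality n; rewrite !mren_rn, fsub_rn, rn_fsub; f_equal.
      * extensionality x; apply mren_rn.
      * extensionality a; apply map_ext; intros; apply mren_rn.
    + now rewrite upren_comp.
    + extensionality a; destruct a as [|a]; simpl; [easy|].
      rewrite map_app; f_equal.
      apply map_map_ext; intros x; rewrite !mren_rn, fsub_rn, rn_fsub; f_equal.
      * extensionality y; apply mren_rn.
      * extensionality b; apply map_ext; intros; apply mren_rn.
  - now rewrite fsub_apps, IHM, apps_app.
Qed.

Lemma rn_as_fsub p q M : rn p q M = fsub (fun x => Var (p x)) q no_args M.
Proof.
  revert p q; induction M; intros p q; simpl; f_equal; auto; rewrite IHM.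
  - f_equal; extensionality n; now destruct n.
  - f_equal; extensionality n; now destruct n.
Qed.

Lemma lsub_as_fsub s M : lsub s M = fsub s ident no_args M.
Proof.
  revert s; induction M; intros s; simpl; f_equal; auto; rewrite IHM;
    rewrite ?upren_id; f_equal.
  extensionality a; now destruct a.
Qed.

Definition at_name (a : nat) (Ns : list term) (b : nat) : list term :=
  if b =? a then Ns else [].

Lemma rsub_as_fsub a N M : rsub a N M = fsub Var ident (at_name a [N]) M.
Proof.
  revert a N; induction M; intros b N; simpl; f_equal; auto.
  - rewrite IHM; f_equal; extensionality n.
    + now destruct n.
    + unfold at_name; now destruct (n =? b).
  - rewrite IHM; rewrite upren_id; f_equal; extensionality n.
    destruct n as [|n]; simpl; [easy|].
    unfold at_name; simpl; now destruct (n =? b).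
  - unfold at_name; destruct (a =? b); simpl; now rewrite IHM.
Qed.

Lemma rho_subst_rn M a : rho_subst M a = rn ident (scons a ident) M.
Proof. unfold rho_subst; rewrite mren_rn; f_equal; extensionality n; now destruct n. Qed.

Lemma beta_subst_fsub M N : beta_subst M N = fsub (scons N Var) ident no_args M.
Proof. unfold beta_subst; rewrite lsub_as_fsub; f_equal; extensionality n; now destruct n. Qed.

Lemma fsub_id M : fsub Var ident no_args M = M.
Proof.
  change Var with (fun x => Var (ident x)); rewrite <- rn_as_fsub.
  induction M; simpl; rewrite ?upren_id; f_equal; auto.
Qed.

Lemma fsub_beta s q r M N :
  fsub s q r (beta_subst M N)
  = beta_subst (fsub (upsub s) q (fun a => map (lren S) (r a)) M) (fsub s q r N).
Proof.
  rewrite !beta_subst_fsub, !fsub_fsub; f_equal.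
  - extensionality n; destruct n as [|n]; simpl; [easy|].
    rewrite lren_rn, fsub_rn; symmetry; apply fsub_id.
  - extensionality a; unfold no_args; simpl; rewrite app_nil_r, map_map.
    symmetry; rewrite <- map_id; apply map_ext; intros x.
    rewrite lren_rn, fsub_rn; apply fsub_id.
Qed.

Lemma fsub_mren_up s q r h M :
  fsub (fun x => mren S (s x)) (upren q) (scons h (fun a => map (mren S) (r a)))
    (mren S M)
  = mren S (fsub s q r M).
Proof.
  rewrite !mren_rn, fsub_rn, rn_fsub; simpl; f_equal.
  - extensionality x; apply mren_rn.
  - extensionality a; apply map_ext; intros; apply mren_rn.
Qed.

Lemma fsub_rsub s q r M N :
  fsub (fun x => mren S (s x)) (upren q) (scons [] (fun a => map (mren S) (r a)))
    (rsub 0 (mren S N) M)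
  = rsub 0 (mren S (fsub s q r N))
      (fsub (fun x => mren S (s x)) (upren q)
         (scons [] (fun a => map (mren S) (r a))) M).
Proof.
  rewrite !rsub_as_fsub, !fsub_fsub; f_equal.
  - extensionality x; simpl; rewrite mren_rn, fsub_rn.
    unfold at_name; simpl. now rewrite rn_as_fsub.
  - extensionality a; destruct a as [|a]; simpl.
    + unfold at_name; simpl; now rewrite fsub_mren_up.
    + unfold at_name; simpl; rewrite app_nil_r, map_map; apply map_ext; intros x.
      rewrite mren_rn, fsub_rn; simpl; now rewrite rn_as_fsub.
Qed.

(** Renaming the bound name to [a] exposes it to the arguments [r a], so on the right they are
    already handed to the bound name. Hence the mu-steps that must precede a rho-step after a
    substitution. *)
Lemma fsub_rho s q r M a :
  fsub s q r (rho_subst M a)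
  = rho_subst (fsub (fun x => mren S (s x)) (upren q)
      (scons (map (mren S) (r a)) (fun b => map (mren S) (r b))) M) (q a).
Proof.
  rewrite !rho_subst_rn, fsub_rn, rn_fsub; f_equal.
  - extensionality x; rewrite mren_rn, rn_rn, rn_as_fsub; symmetry; apply fsub_id.
  - extensionality b; now destruct b.
  - extensionality b; destruct b as [|b]; simpl;
      (rewrite map_map; symmetry; rewrite <- map_id; apply map_ext; intros x;
       rewrite mren_rn, rn_rn, rn_as_fsub; apply fsub_id).
Qed.

(** * The relation [std] *)

Inductive hstep : term -> term -> Prop :=
| hstep_beta M N : hstep (App (Lam M) N) (beta_subst M N)
| hstep_mu M N : hstep (App (Mu M) N) (Mu (rsub 0 (mren S N) M))
| hstep_app M M' N : hstep M M' -> hstep (App M N) (App M' N).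

(** These terms are not typable, as [Name a M] has type [Bot].  Letting them be
    related to every term by [std] frees the lemmas on [std] from typability. *)
Inductive stuck : term -> Prop :=
| stuck_name a M N : stuck (App (Name a M) N)
| stuck_app M N : stuck M -> stuck (App M N).

(** [spine] covers the sequences that keep the head of the term, also when it is
    a [Mu] without arguments. *)
Inductive std : term -> nat -> term -> Prop :=
| std_head M M' n N : hstep M M' -> std M' n N -> std M (S n) N
| std_spine M n N : spine M n N -> std M n N
| std_theta M n P : std M n (Name 0 (mren S P)) -> std (Mu M) (S n) P
| std_name a M n N : std M n N -> std (Name a M) n (Name a N)
| std_rho a M n V : std M n (Mu V) -> std (Name a M) (S n) (rho_subst V a)
| std_stuck M n N : stuck M -> std M n N
with spine : term -> nat -> term -> Prop :=
| spine_var x : spine (Var x) 0 (Var x)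
| spine_lam M n N : std M n N -> spine (Lam M) n (Lam N)
| spine_mu M n N : std M n N -> spine (Mu M) n (Mu N)
| spine_app M n M' N k N' :
    spine M n M' -> std N k N' -> spine (App M N) (n + k) (App M' N').

#[local] Hint Constructors std spine : core.

Scheme std_mind := Induction for std Sort Prop
with spine_mind := Induction for spine Sort Prop.
Combined Scheme std_spine_ind from std_mind, spine_mind.

Lemma hstep_fsub s q r M M' : hstep M M' -> hstep (fsub s q r M) (fsub s q r M').
Proof.
  induction 1; simpl.
  - rewrite fsub_beta; constructor.
  - rewrite fsub_rsub; constructor.
  - now constructor.
Qed.

Lemma hstep_rn p q M M' : hstep M M' -> hstep (rn p q M) (rn p q M').
Proof. rewrite !rn_as_fsub; apply hstep_fsub. Qed.

Lemma hstep_apps M M' Ns : hstep M M' -> hstep (apps M Ns) (apps M' Ns).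
Proof. revert M M'; induction Ns; simpl; auto using hstep_app. Qed.

Lemma stuck_fsub s q r M : stuck M -> stuck (fsub s q r M).
Proof. induction 1; simpl; now constructor. Qed.

Lemma stuck_rn p q M : stuck M -> stuck (rn p q M).
Proof. rewrite rn_as_fsub; apply stuck_fsub. Qed.

Lemma stuck_apps M Ns : stuck M -> stuck (apps M Ns).
Proof. revert M; induction Ns; simpl; auto using stuck_app. Qed.

Lemma rn_mren_up p q P : rn p (upren q) (mren S P) = mren S (rn p q P).
Proof. now rewrite !mren_rn, !rn_rn. Qed.

Lemma rn_rho p q V a : rn p q (rho_subst V a) = rho_subst (rn p (upren q) V) (q a).
Proof.
  rewrite !rho_subst_rn, !rn_rn; f_equal; extensionality b; now destruct b.
Qed.

Lemma std_spine_rn :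
  (forall M n N, std M n N -> forall p q, std (rn p q M) n (rn p q N)) /\
  (forall M n N, spine M n N -> forall p q, spine (rn p q M) n (rn p q N)).
Proof.
  apply std_spine_ind; intros; simpl; eauto using hstep_rn, stuck_rn.
  - apply std_theta; rewrite <- rn_mren_up; apply H.
  - rewrite rn_rho; apply std_rho, H.
Qed.

Lemma std_mren q M n N : std M n N -> std (mren q M) n (mren q N).
Proof. rewrite !mren_rn; intros H; now apply (proj1 std_spine_rn). Qed.

Lemma std_lren p M n N : std M n N -> std (lren p M) n (lren p N).
Proof. rewrite !lren_rn; intros H; now apply (proj1 std_spine_rn). Qed.

(** [std] has no clause for applications, so the induction records what stands in function position:
    a spine extends to the application, and a naming makes it stuck. *)
Lemma std_refl M : std M 0 M.
Proof.
  enough (spine M 0 M \/ stuck M \/ exists a M', M = Name a M' /\ std M' 0 M')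
    as [H | [H | (a & M' & -> & H)]] by auto.
  induction M as [x | M IH | M IH | a M IH | M IHM N IHN].
  - left; constructor.
  - left; constructor. destruct IH as [H | [H | (a & M' & -> & H)]]; auto.
  - left; constructor. destruct IH as [H | [H | (a & M' & -> & H)]]; auto.
  - right; right; exists a, M; split; [easy|].
    destruct IH as [H | [H | (b & M' & -> & H)]]; auto.
  - assert (std N 0 N) by
      (destruct IHN as [H | [H | (b & M' & -> & H)]]; auto).
    destruct IHM as [H' | [H' | (b & M' & -> & H')]].
    + left; now apply (spine_app M 0 M N 0 N).
    + right; left; now constructor.
    + right; left; constructor.
Qed.

(** The index [j] is the number of arguments to which the term is applied. *)
Inductive ctx (R : nat -> term -> term -> Prop) : nat -> term -> term -> Prop :=
| ctx_root j M N : R j M N -> ctx R j M N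
| ctx_lam j M N : ctx R 0 M N -> ctx R j (Lam M) (Lam N)
| ctx_mu j M N : ctx R 0 M N -> ctx R j (Mu M) (Mu N)
| ctx_name j a M N : ctx R 0 M N -> ctx R j (Name a M) (Name a N)
| ctx_fun j M M' N : ctx R (S j) M M' -> ctx R j (App M N) (App M' N)
| ctx_arg j M N N' : ctx R 0 N N' -> ctx R j (App M N) (App M N').

#[local] Hint Constructors ctx : core.

(** The steps that can be appended at the price of exactly one step. Theta is limited to redexes
    without arguments, since arguments would first have to be absorbed. *)
Inductive simple_root : nat -> term -> term -> Prop :=
| simple_rho j a V : simple_root j (Name a (Mu V)) (rho_subst V a)
| simple_theta P : simple_root 0 (Mu (Name 0 (mren S P))) P.

(** The first index is at most the weight of the redex.  For a beta-redex it is a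
    local quantity, which does not change when the surrounding term grows. *)
Inductive root : nat -> nat -> term -> term -> Prop :=
| root_beta j U Q : root (2 * comp U + j) j (App (Lam U) Q) (beta_subst U Q)
| root_mu j U Q : root (mocc 0 U) j (App (Mu U) Q) (Mu (rsub 0 (mren S Q) U))
| root_rho j a V : root 1 j (Name a (Mu V)) (rho_subst V a)
| root_theta j P : root (2 * j - 1) j (Mu (Name 0 (mren S P))) P.

(** * Steps and renamings of names *)

Definition rn_forward (R : nat -> term -> term -> Prop) : Prop :=
  forall q j M N, R j M N -> R j (mren q M) (mren q N).

(** Carries a step performed after a renaming back before it. This must cover renamings that
    identify names, as rho does; redexes and their indices depend only on shape, size and bound
    names, which [upren] keeps apart from the others. *)
Definition rn_backward (R : nat -> term -> term -> Prop) : Prop :=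
  forall q j M X, R j (mren q M) X -> exists N, R j M N /\ X = mren q N.

Lemma ctx_forward R : rn_forward R -> rn_forward (ctx R).
Proof.
  intros F q j M N H; revert q.
  induction H; intros q; simpl; [apply ctx_root, F; easy | apply ctx_lam
    | apply ctx_mu | apply ctx_name | apply ctx_fun | apply ctx_arg]; auto.
Qed.

Lemma ctx_backward R : rn_backward R -> rn_backward (ctx R).
Proof.
  intros B q j M; revert q j.
  induction M; intros q j X H; inversion H; subst;
    try (match goal with HR : R _ _ _ |- _ =>
      apply B in HR as (? & ? & ->); eauto; fail end);
    match goal with HR : ctx R _ (mren ?q ?M) _,
        IH : forall q j X, ctx R j (mren q ?M) X -> _ |- _ =>
      apply IH in HR as (? & ? & ->); eexists; split; [eauto | easy] end.
Qed.

Lemma mren_occ_ext q q' M :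
  (forall a, 0 < mocc a M -> q a = q' a) -> mren q M = mren q' M.
Proof.
  revert q q'; induction M; intros q q' H; simpl in *; f_equal.
  - auto.
  - apply IHM; intros [|b] Hb; simpl; auto.
  - apply H; rewrite Nat.eqb_refl; lia.
  - apply IHM; intros; apply H; lia.
  - apply IHM1; intros; apply H; lia.
  - apply IHM2; intros; apply H; lia.
Qed.

Lemma mocc_mren q a M :
  (forall b, q b = q a -> b = a) -> mocc (q a) (mren q M) = mocc a M.
Proof.
  revert q a; induction M; intros q b H; simpl; auto.
  - change (S (q b)) with (upren q (S b)); apply IHM.
    intros [|c]; simpl; intros E; [easy|]; f_equal; apply H; congruence.
  - rewrite IHM by easy; f_equal.
    destruct (Nat.eqb_spec (q b) (q a)) as [E|E], (Nat.eqb_spec b a) as [E'|E'];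
      try easy; exfalso; [apply E'; symmetry; auto | congruence].
Qed.

Lemma mocc_0_upren q M : mocc 0 (mren (upren q) M) = mocc 0 M.
Proof. apply (mocc_mren (upren q) 0); now intros [|b]. Qed.

Lemma mocc_notin q a M : (forall b, q b <> a) -> mocc a (mren q M) = 0.
Proof.
  revert q a; induction M; intros q b H; simpl; auto.
  - apply IHM; intros [|c]; simpl; [easy|]; intros E; apply (H c); congruence.
  - rewrite IHM by easy. destruct (Nat.eqb_spec b (q a)); [exfalso; eapply H; eauto|easy].
  - now rewrite IHM1, IHM2.
Qed.

Lemma mocc_0_mren_S M : mocc 0 (mren S M) = 0.
Proof. now apply mocc_notin. Qed.

Lemma mren_mren q q' M : mren q (mren q' M) = mren (fun n => q (q' n)) M.
Proof. now rewrite !mren_rn, rn_rn. Qed.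

Lemma mren_ident M : mren ident M = M.
Proof. rewrite mren_rn, rn_as_fsub; apply fsub_id. Qed.

Lemma mlower_S M : mlower (mren S M) = M.
Proof. unfold mlower; rewrite mren_mren; apply mren_ident. Qed.

Lemma mren_S_mlower M : mocc 0 M = 0 -> mren S (mlower M) = M.
Proof.
  intros H; unfold mlower; rewrite mren_mren; rewrite <- (mren_ident M) at 2.
  apply mren_occ_ext; intros [|a] Ha; simpl; [lia | easy].
Qed.

Lemma comp_mren q M : comp (mren q M) = comp M.
Proof. revert q; induction M; intros q; simpl; auto. Qed.

Lemma mren_beta q M N : mren q (beta_subst M N) = beta_subst (mren q M) (mren q N).
Proof.
  rewrite !mren_rn, !rn_as_fsub, fsub_beta; f_equal; f_equal.
  extensionality n; now destruct n.
Qed.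

Lemma mren_rsub q M N :
  mren (upren q) (rsub 0 (mren S N) M) = rsub 0 (mren S (mren q N)) (mren (upren q) M).
Proof.
  pose proof (fsub_rsub Var q no_args M N) as E.
  replace (scons [] (fun a => map (mren S) (no_args a))) with no_args in E
    by (extensionality n; now destruct n).
  rewrite !(mren_rn (upren q)), (mren_rn q N), !rn_as_fsub; exact E.
Qed.

Lemma mren_rho q V a : mren q (rho_subst V a) = rho_subst (mren (upren q) V) (q a).
Proof. rewrite !mren_rn; apply rn_rho. Qed.

Lemma mren_S_up q P : mren (upren q) (mren S P) = mren S (mren q P).
Proof. now rewrite !mren_mren. Qed.

(** Only 0 is sent to 0 by [upren q], so a name 0 missing from the image was missing from [P]. In
    this way theta-redexes are reflected by renamings. *)
Lemma mren_eq_S q P X :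
  mren (upren q) P = mren S X -> exists P', P = mren S P' /\ X = mren q P'.
Proof.
  intros E; exists (mlower P).
  assert (mocc 0 P = 0) as H
    by (rewrite <- (mocc_0_upren q), E; apply mocc_0_mren_S).
  split; [now rewrite mren_S_mlower |].
  rewrite <- (mlower_S X), <- E, <- (mren_S_mlower P H) at 1.
  now rewrite mren_S_up, mlower_S.
Qed.

Lemma simple_root_forward : rn_forward simple_root.
Proof.
  intros q j M N [j' a V | P]; simpl.
  - rewrite mren_rho; constructor.
  - rewrite mren_S_up; constructor.
Qed.

Lemma simple_root_backward : rn_backward simple_root.
Proof.
  intros q j M X H; remember (mren q M) as Y eqn:E; destruct H.
  - destruct M as [| | | b [| |V'| |]|]; try discriminate E; injection E as -> ->.
    exists (rho_subst V' b); split; [constructor | now rewrite mren_rho].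
  - destruct M as [| | [| | |b M|] | |]; try discriminate E; injection E as E1 E2.
    destruct b as [|b]; [|discriminate E1].
    symmetry in E2; apply mren_eq_S in E2 as (P' & -> & ->).
    exists P'; split; [constructor | easy].
Qed.

Lemma root_forward f : rn_forward (root f).
Proof.
  intros q j M N []; simpl.
  - rewrite mren_beta, <- (comp_mren q U); constructor.
  - rewrite mren_rsub, <- (mocc_0_upren q U); constructor.
  - rewrite mren_rho; constructor.
  - rewrite mren_S_up; constructor.
Qed.

Lemma root_backward f : rn_backward (root f).
Proof.
  intros q j M X H; remember (mren q M) as Y eqn:E; destruct H.
  - destruct M as [| | | | [|U'| | |] Q']; try discriminate E; injection E as -> ->.
    rewrite comp_mren; exists (beta_subst U' Q'); split; [constructor | now rewrite mren_beta].
  - destruct M as [| | | | [| |U'| |] Q']; try discriminate E; injection E as -> ->.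
    rewrite mocc_0_upren; eexists; split; [constructor | simpl; now rewrite mren_rsub].
  - destruct M as [| | | b [| |V'| |]|]; try discriminate E; injection E as -> ->.
    exists (rho_subst V' b); split; [constructor | now rewrite mren_rho].
  - destruct M as [| | [| | |b M|] | |]; try discriminate E; injection E as E1 E2.
    destruct b as [|b]; [|discriminate E1].
    symmetry in E2; apply mren_eq_S in E2 as (P' & -> & ->).
    exists P'; split; [constructor | easy].
Qed.

(** Contracting a theta-redex at the head turns a spine into an instance of [std_theta], which can
    happen only without arguments; for [0 < j] the result is again a spine, as the application case
    requires. *)
Lemma std_spine_simple :
  (forall M n N, std M n N -> forall N', ctx simple_root 0 N N' -> std M (S n) N') /\
  (forall M n N, spine M n N -> forall j N', ctx simple_root j N N' ->
     std M (S n) N' /\ (0 < j -> spine M (S n) N')).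
Proof.
  apply std_spine_ind.
  - intros; eauto.
  - intros M n N _ IH N' H; now apply (IH 0).
  - intros M n P _ IH N' H; apply std_theta, IH.
    apply ctx_name, ctx_forward; [exact simple_root_forward | exact H].
  - intros a M n N HS IH N' H; inversion H as [? ? ? R | | | ? ? ? ? R | |]; subst.
    + inversion R; subst; now apply std_rho.
    + now apply std_name, IH.
  - intros a M n V _ IH N' H.
    (* The new step is inserted before the pending rho-step, which stays last. *)
    apply (ctx_backward _ simple_root_backward) in H as (V' & H & ->).
    apply std_rho, IH; now apply ctx_mu.
  - intros; now apply std_stuck.
  - intros x j N' H; inversion H as [? ? ? R | | | | |]; inversion R.
  - intros M n N _ IH j N' H; inversion H as [? ? ? R | | | | |]; subst.
    + inversion R.
    + split; intros; [apply std_spine|]; now apply spine_lam, IH.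
  - intros M n N HS IH j N' H; inversion H as [? ? ? R | | | | |]; subst.
    + inversion R; subst; split; [now apply std_theta | lia].
    + split; intros; [apply std_spine|]; now apply spine_mu, IH.
  - intros M n M' N k N' HM IHM HN IHN j X H.
    inversion H as [? ? ? R | | | | ? ? ? ? R | ? ? ? ? R]; subst.
    + inversion R.
    + apply IHM in R as [_ HM']; specialize (HM' ltac:(lia)).
      assert (spine (App M N) (S (n + k)) (App M'0 N')) by (now apply (spine_app M (S n))).
      split; auto.
    + apply IHN in R.
      assert (spine (App M N) (S (n + k)) (App M' N'0))
        by (rewrite plus_n_Sm; now apply spine_app).
      split; auto.
Qed.

Lemma std_simple M n N N' : std M n N -> ctx simple_root 0 N N' -> std M (S n) N'.
Proof. intros H; now apply (proj1 std_spine_simple). Qed.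

Lemma stuck_inv_mu M : ~ stuck (Mu M).
Proof. intros H; inversion H. Qed.

(** A theta-step with result [Mu V] contracts [Mu (Name 0 (Mu W))], for which
    contracting [Name 0 (Mu W)] by rho does the same. *)
Lemma std_mu_inv M n V : std (Mu M) n (Mu V) -> std M n V.
Proof.
  intros H; inversion H as [? ? ? ? Hh | ? ? ? Hs | ? ? ? Ht | | |]; subst.
  - inversion Hh.
  - now inversion Hs.
  - apply std_simple with (N' := rho_subst (mren (upren S) V) 0) in Ht.
    + unfold rho_subst in Ht; rewrite mren_mren in Ht.
      rewrite (mren_occ_ext _ ident), mren_ident in Ht; [easy |].
      now intros [|a] _.
    + apply ctx_root; simpl; constructor.
  - now apply stuck_inv_mu in H0.
Qed.

(** * Substitution and application *)

Inductive stds : list term -> nat -> list term -> Prop :=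
| stds_nil : stds [] 0 []
| stds_cons M n N Ms k Ns :
    std M n N -> stds Ms k Ns -> stds (M :: Ms) (n + k) (N :: Ns).
#[local] Hint Constructors stds : core.

Lemma stds_rn p q Ms k Ns :
  stds Ms k Ns -> stds (map (rn p q) Ms) k (map (rn p q) Ns).
Proof.
  induction 1; simpl; constructor; [now apply (proj1 std_spine_rn) | easy].
Qed.

Lemma stds_mren q Ms k Ns :
  stds Ms k Ns -> stds (map (mren q) Ms) k (map (mren q) Ns).
Proof. rewrite !(map_ext _ _ (mren_rn q)); apply stds_rn. Qed.

Lemma stds_lren p Ms k Ns :
  stds Ms k Ns -> stds (map (lren p) Ms) k (map (lren p) Ns).
Proof. rewrite !(map_ext _ _ (lren_rn p)); apply stds_rn. Qed.

Lemma spine_apps M n N Ms k Ns :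
  spine M n N -> stds Ms k Ns -> spine (apps M Ms) (n + k) (apps N Ns).
Proof.
  intros H Hs; revert M n N H; induction Hs as [|A nA A' As k As' HA HAs IH];
    intros M n N H; simpl.
  - now rewrite Nat.add_0_r.
  - rewrite Nat.add_assoc; apply IH; now apply spine_app.
Qed.

(** Cost of reducing, inside [M] applied to [j] arguments, what a substitution has
    inserted: [w x i] for an occurrence of [x] with [i] arguments, and [l a] for an
    occurrence of [a], whose subterm receives [len a] further arguments. *)
Fixpoint cost (w : nat -> nat -> nat) (len l : nat -> nat) (j : nat)
    (M : term) : nat :=
  match M with
  | Var x => w x j
  | Lam M => cost (scons (fun _ => 0) w) len l 0 M
  | Mu M => cost w (scons 0 len) (scons 0 l) 0 M
  | Name a M => cost w len l (len a) M + l a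
  | App M N => cost w len l (S j) M + cost w len l 0 N
  end.

(** Two prices for a reduced copy of an inserted term: from below its own length, from above its
    length after application to [j] arguments, with the factor [j + 1] of [apps_std]. *)
Definition low (k : nat -> nat) (x j : nat) : nat := k x.
Definition upp (k : nat -> nat) (x j : nat) : nat := (j + 1) * k x.

Lemma scons_low k : scons (fun _ => 0) (low k) = low (scons 0 k).
Proof. extensionality x; extensionality j; now destruct x. Qed.

Lemma scons_upp k : scons (fun _ => 0) (upp k) = upp (scons 0 k).
Proof.
  extensionality x; extensionality j; destruct x; unfold upp; simpl; lia.
Qed.

Lemma scons_upren {T} (h : T) f q :
  (fun a => scons h f (upren q a)) = scons h (fun a => f (q a)).
Proof. extensionality a; now destruct a. Qed.

Lemma cost_mren w len l j q M :
  cost w len l j (mren q M) = cost w (fun a => len (q a)) (fun a => l (q a)) j M.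
Proof.
  revert w len l j q; induction M; intros w len l j q; simpl; auto.
  now rewrite IHM, !scons_upren.
Qed.

Lemma cost_low_upp k len l j M : cost (low k) len l j M <= cost (upp k) len l j M.
Proof.
  revert k len l j; induction M; intros k len l j; simpl.
  - unfold low, upp; nia.
  - rewrite scons_low, scons_upp; apply IHM.
  - apply IHM.
  - apply Nat.add_le_mono; auto.
  - apply Nat.add_le_mono; auto.
Qed.

Definition apps_std : Prop :=
  forall M n M' Ns k Ns', std M n M' -> stds Ns k Ns' ->
  exists n', std (apps M Ns) n' (apps M' Ns') /\
    n + k <= n' <= (length Ns + 1) * n + k.

(** The alternative serves to prove [apps_std] as the special case of variables
    of the statement that otherwise depends on it. *)
Record env (s s' : nat -> term) (k : nat -> nat) (r r' : nat -> list term)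
    (l : nat -> nat) (J : nat) : Prop := {
  env_std : forall x, std (s x) (k x) (s' x);
  env_var : apps_std \/ forall x, exists y, s x = Var y /\ s' x = Var y;
  env_args : forall a, stds (r a) (l a) (r' a);
  env_len : forall a, length (r a) <= J }.

Lemma env_lam s s' k r r' l J :
  env s s' k r r' l J ->
  env (upsub s) (upsub s') (scons 0 k) (fun a => map (lren S) (r a))
    (fun a => map (lren S) (r' a)) l J.
Proof.
  intros [H1 H2 H3 H4]; split.
  - intros [|x]; simpl; [apply std_refl | now apply std_lren].
  - destruct H2 as [H2 | H2]; [now left | right].
    intros [|x]; simpl; [now exists 0 |].
    destruct (H2 x) as (y & -> & ->); now exists (S y).
  - intros a; now apply stds_lren.
  - intros a; now rewrite length_map.
Qed.

Lemma env_mu s s' k r r' l J Ns b Ns' :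
  env s s' k r r' l J -> stds Ns b Ns' -> length Ns <= J ->
  env (fun x => mren S (s x)) (fun x => mren S (s' x)) k
    (scons (map (mren S) Ns) (fun a => map (mren S) (r a)))
    (scons (map (mren S) Ns') (fun a => map (mren S) (r' a))) (scons b l) J.
Proof.
  intros [H1 H2 H3 H4] HN HJ; split.
  - intros x; now apply std_mren.
  - destruct H2 as [H2 | H2]; [now left | right].
    intros x; destruct (H2 x) as (y & -> & ->); now exists y.
  - intros [|a]; simpl; now apply stds_mren.
  - intros [|a]; simpl; now rewrite length_map.
Qed.

Lemma length_lift_lren (r : nat -> list term) :
  (fun a => length (map (lren S) (r a))) = (fun a => length (r a)).
Proof. extensionality a; apply length_map. Qed.

Lemma length_lift_mren Ns (r : nat -> list term) :
  (fun a => length (scons (map (mren S) Ns) (fun a => map (mren S) (r a)) a))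
  = scons (length Ns) (fun a => length (r a)).
Proof. extensionality a; destruct a; simpl; apply length_map. Qed.

(** Lifted terms do not contain the name 0, so handing [Ns] to it after a substitution amounts to
    entering them in the substitution itself. *)
Lemma mu_args_fsub s q r Ns M :
  fsub Var ident (scons (map (mren S) Ns) no_args)
    (fsub (fun x => mren S (s x)) (upren q)
       (scons [] (fun a => map (mren S) (r a))) M)
  = fsub (fun x => mren S (s x)) (upren q)
      (scons (map (mren S) Ns) (fun a => map (mren S) (r a))) M.
Proof.
  assert (forall N, fsub Var ident (scons (map (mren S) Ns) no_args) (mren S N)
                    = mren S N) as E
    by (intros N; rewrite mren_rn, fsub_rn, rn_as_fsub; reflexivity).
  rewrite fsub_fsub; f_equal.
  - extensionality x; apply E.
  - extensionality a; destruct a as [|a]; simpl; [easy|].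
    rewrite app_nil_r, map_map; apply map_ext; intros; apply E.
Qed.

(** One mu-step per argument; the successive [:=_r] compose to a single substitution that gives the
    whole list to the name 0. *)
Lemma std_mu_args M Ns n N :
  std (Mu (fsub Var ident (scons (map (mren S) Ns) no_args) M)) n N ->
  std (apps (Mu M) Ns) (length Ns + n) N.
Proof.
  revert M; induction Ns as [|A Ns IH]; intros M H; simpl in *.
  - replace (scons [] no_args) with no_args in H
      by (extensionality a; now destruct a).
    now rewrite fsub_id in H.
  - apply (std_head _ (apps (Mu (rsub 0 (mren S A) M)) Ns));
      [apply hstep_apps; constructor |].
    apply IH.
    replace (fsub _ _ _ (rsub 0 (mren S A) M))
      with (fsub Var ident (scons (mren S A :: map (mren S) Ns) no_args) M);
      [exact H|].
    rewrite rsub_as_fsub, fsub_fsub; f_equal.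
    extensionality a; destruct a as [|a]; simpl; [|easy].
    f_equal; rewrite mren_rn, fsub_rn, rn_as_fsub; reflexivity.
Qed.

(** * Reduction inside substitution instances *)

Definition reach (M N : term) (lo hi : nat) : Prop :=
  exists n, std M n N /\ lo <= n <= hi.

(** The arguments [Ns] outside the substitution let the induction pass through namings, where [r a]
    is appended to the subterm. All these lists are bounded by [J]: a theta- or rho-step of [M] may
    need up to [J] mu-steps before it, whence the factor [J + 1]. *)
Definition subst_reach (n : nat) (M : term) : Prop :=
  forall N s s' q k r r' l J Ns b Ns',
  std M n N -> env s s' k r r' l J -> stds Ns b Ns' -> length Ns <= J ->
  reach (apps (fsub s q r M) Ns) (apps (fsub s' q r' N) Ns')
    (n + cost (low k) (fun a => length (r a)) l (length Ns) N + b)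
    ((J + 1) * n + cost (upp k) (fun a => length (r a)) l (length Ns) N + b).

(** Needed for a rho-step on [a]: after the substitution its redex is
    [[a]((mu b.V) Ns)], where [Ns] must first be absorbed. *)
Definition subst_reach_mu (n : nat) (M : term) : Prop :=
  forall V s s' q k r r' l J Ns b Ns',
  std M n (Mu V) -> env s s' k r r' l J -> stds Ns b Ns' -> length Ns <= J ->
  let len := scons (length Ns) (fun a => length (r a)) in
  reach (apps (fsub s q r M) Ns)
    (Mu (fsub (fun x => mren S (s' x)) (upren q)
           (scons (map (mren S) Ns') (fun a => map (mren S) (r' a))) V))
    (n + cost (low k) len (scons b l) 0 V)
    ((J + 1) * n + length Ns + cost (upp k) len (scons b l) 0 V).

Lemma comp_pos M : 0 < comp M.
Proof. induction M; simpl; lia. Qed.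

(** On the way to the head the arguments of the spine join [Ns], which may thus outgrow [J]. Only an
    inserted head is sensitive to the length of this list, and [cost] accounts for that. *)
Lemma spine_subst_reach n0 c :
  (forall n M, n <= n0 -> comp M < c -> subst_reach n M) ->
  forall M n N s s' q k r r' l J Ns b Ns',
  spine M n N -> n <= n0 -> comp M <= c ->
  env s s' k r r' l J -> stds Ns b Ns' ->
  reach (apps (fsub s q r M) Ns) (apps (fsub s' q r' N) Ns')
    (n + cost (low k) (fun a => length (r a)) l (length Ns) N + b)
    ((J + 1) * n + cost (upp k) (fun a => length (r a)) l (length Ns) N + b).
Proof.
  intros IHc M; induction M as [x | M _ | M _ | a M _ | A IHA B _];
    intros n N s s' q k r r' l J Ns b Ns' H Hn Hc He HNs; inversion H; subst; simpl.
  - destruct He as [Hs [App | Hv] _ _].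
    (* The only place where an inserted term gets applied, and so the only appeal to [apps_std]. *)
    + destruct (App _ _ _ _ _ _ (Hs x) HNs) as (n & Hn' & Hb).
      exists n; split; [easy|]; unfold low, upp; nia.
    + specialize (Hs x); destruct (Hv x) as (y & E & E'); rewrite E, E' in *.
      assert (k x = 0) as Hk.
      { inversion Hs as [? ? ? ? Hh | ? ? ? Hsp | | | | ? ? ? Hst]; subst.
        - inversion Hh.
        - now inversion Hsp.
        - inversion Hst. }
      exists (0 + b); split; [apply std_spine, spine_apps; easy|].
      unfold low, upp; rewrite Hk; lia.
  - simpl in Hc.
    destruct (IHc n M Hn ltac:(lia) _ _ _ q _ _ _ _ _ [] 0 [] H1 (env_lam _ _ _ _ _ _ _ He)
                stds_nil ltac:(simpl; lia)) as (n' & Hn' & Hb).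
    simpl in *; rewrite length_lift_lren in Hb; rewrite scons_low, scons_upp.
    exists (n' + b); split; [apply std_spine, spine_apps; auto | lia].
  - simpl in Hc.
    destruct (IHc n M Hn ltac:(lia) _ _ _ (upren q) _ _ _ _ _ [] 0 [] H1
                (env_mu _ _ _ _ _ _ _ _ _ _ He stds_nil ltac:(simpl; lia))
                stds_nil ltac:(simpl; lia)) as (n' & Hn' & Hb).
    rewrite length_lift_mren in Hb; simpl in *.
    exists (n' + b); split; [apply std_spine, spine_apps; auto | lia].
  - simpl in Hc; pose proof (comp_pos A).
    rename n1 into nA, M' into A', k0 into nB, N' into B'.
    destruct (IHc nB B ltac:(lia) ltac:(lia) _ _ _ q _ _ _ _ _ [] 0 [] H5 He
                stds_nil ltac:(simpl; lia)) as (m & Hm & Hb).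
    simpl in *.
    destruct (IHA _ _ _ _ q _ _ _ _ _ _ _ _ H2 ltac:(lia) ltac:(lia) He
                (stds_cons _ _ _ _ _ _ Hm HNs)) as (n' & Hn' & Hb').
    exists n'; split; [exact Hn'|]. simpl in *; nia.
Qed.

Lemma stuck_name_apps a M A Ns : stuck (apps (Name a M) (A :: Ns)).
Proof. apply (stuck_apps (App (Name a M) A)); constructor. Qed.

Lemma subst_reach_step n M :
  (forall n' M', n' < n -> subst_reach n' M' /\ subst_reach_mu n' M') ->
  (forall M', comp M' < comp M -> subst_reach n M') ->
  subst_reach n M.
Proof.
  intros IHn IHc N s s' q k r r' l J Ns b Ns' H He HNs HJ.
  inversion H as [? M' m ? Hh Hm | ? ? ? Hsp | M1 m P HP | a M1 ? N1 HN1
                  | a M1 m V HV | ? ? ? Hst]; subst.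
  - destruct (IHn m M') as [IH _]; [lia|].
    destruct (IH _ _ _ q _ _ _ _ _ _ _ _ Hm He HNs HJ) as (n' & Hn' & Hb).
    exists (S n'); split; [|lia].
    eapply std_head; [apply hstep_apps, hstep_fsub, Hh | exact Hn'].
  - apply (spine_subst_reach n (comp M)); auto.
    intros m M' Hm Hc; destruct (Nat.eq_dec m n) as [->|]; [now apply IHc|].
    apply IHn; lia.
  (* Once [Ns] is absorbed by [Mu], the naming carries it to the place that theta exposes: the final
     [[0]P] of the body becomes [[0](P Ns)]. *)
  - destruct (IHn m M1) as [IH _]; [lia|].
    destruct (IH _ _ _ (upren q) _ _ _ _ _ [] 0 [] HP
                (env_mu _ _ _ _ _ _ _ _ _ _ He HNs HJ) stds_nil ltac:(simpl; lia))
      as (n' & Hn' & Hb).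
    rewrite length_lift_mren in Hb; simpl in Hn', Hb.
    rewrite !cost_mren in Hb; simpl in Hb.
    rewrite fsub_mren_up in Hn'.
    exists (length Ns + S n'); split; [|change (fun a : nat => l a) with l in Hb; lia].
    apply std_mu_args; rewrite mu_args_fsub; apply std_theta.
    replace (mren S (apps _ Ns'))
      with (apps (mren S (fsub s' q r' N)) (map (mren S) Ns')); [exact Hn'|].
    rewrite !(map_ext _ _ (mren_rn S)), !mren_rn; symmetry; apply rn_apps.
  - destruct Ns as [|A Ns].
    + inversion HNs; subst; simpl.
      destruct (IHc M1 ltac:(simpl; lia) _ _ _ q _ _ _ _ _ _ _ _ HN1 He
                  (env_args _ _ _ _ _ _ _ He a) (env_len _ _ _ _ _ _ _ He a))
        as (n' & Hn' & Hb).
      exists n'; split; [now apply std_name | lia].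
    (* A stuck term reaches anything in any number of steps; the upper bound is chosen, which leaves
       [low] to be compared with [upp]. *)
    + eexists; split; [apply std_stuck, stuck_name_apps|].
      split; [|apply le_n].
      pose proof (cost_low_upp k (fun a => length (r a)) l (length (A :: Ns)) (Name a N1)); nia.
  - destruct Ns as [|A Ns].
    + inversion HNs; subst; simpl.
      destruct (IHn m M1) as [_ IH]; [lia|].
      destruct (IH _ _ _ q _ _ _ _ _ _ _ _ HV He
                  (env_args _ _ _ _ _ _ _ He a) (env_len _ _ _ _ _ _ _ He a))
        as (n' & Hn' & Hb).
      (* At most [J] mu-steps to absorb [r a], together with the rho-step itself, use up the factor
         [J + 1]. *)
      pose proof (env_len _ _ _ _ _ _ _ He a).
      exists (S n'); split.
      * rewrite fsub_rho; now apply std_rho.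
      * unfold rho_subst; rewrite !cost_mren.
        replace (fun a0 => length (r match a0 with 0 => a | S n => n end))
          with (scons (length (r a)) (fun a => length (r a)))
          by (extensionality c; now destruct c).
        replace (fun a0 => l match a0 with 0 => a | S n => n end)
          with (scons (l a) l) by (extensionality c; now destruct c).
        lia.
    + eexists; split; [apply std_stuck, stuck_name_apps|].
      split; [|apply le_n].
      pose proof (cost_low_upp k (fun a => length (r a)) l (length (A :: Ns)) (rho_subst V a)); nia.
  - eexists; split; [now apply std_stuck, stuck_apps, stuck_fsub|].
    split; [|apply le_n].
      pose proof (cost_low_upp k (fun a => length (r a)) l (length Ns) N); nia.
Qed.

Lemma subst_reach_mu_step n M :
  (forall n' M', n' < n -> subst_reach_mu n' M') ->
  (forall M', comp M' <= comp M -> subst_reach n M') ->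
  subst_reach_mu n M.
Proof.
  intros IHn IHc V s s' q k r r' l J Ns b Ns' H He HNs HJ len.
  destruct Ns as [|A Ns].
  { inversion HNs; subst.
    destruct (IHc M ltac:(lia) _ _ _ q _ _ _ _ _ _ _ _ H He HNs HJ) as (n' & Hn' & Hb).
    subst len; simpl in *; exists n'; split; [easy | simpl in *; lia]. }
  assert ((exists M1, M = Mu M1) \/ stuck (apps (fsub s q r M) (A :: Ns)) \/
     exists M' m, n = S m /\ hstep M M' /\ std M' m (Mu V))
    as [[M1 ->] | [Hst | (M' & m & -> & Hh & Hm)]].
  { inversion H as [? M' m ? Hh Hm | ? ? ? Hsp | M1 m P HP | a M1 ? N1 HN1
                  | a M1 m V' HV | ? ? ? Hst]; subst.
    - right; right; eauto.
    - inversion Hsp; subst; eauto.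
    - eauto.
    - right; left; apply stuck_name_apps.
    - right; left; now apply stuck_apps, stuck_fsub. }
  (* Even when [Mu V] arises by theta, the body reaches [V] at the same price, so the prefix [Mu]
     can be kept to absorb the arguments. *)
  - apply std_mu_inv in H.
    destruct (IHc M1 ltac:(simpl; lia) _ _ _ (upren q) _ _ _ _ _ [] 0 [] H
                (env_mu _ _ _ _ _ _ _ _ _ _ He HNs HJ) stds_nil ltac:(simpl; lia))
      as (n' & Hn' & Hb).
    rewrite length_lift_mren in Hb; simpl in Hn', Hb.
    exists (length (A :: Ns) + n'); split; [|subst len; simpl in *; lia].
    apply (std_mu_args _ (A :: Ns)); rewrite mu_args_fsub.
    now apply std_spine, spine_mu.
  - eexists; split; [now apply std_stuck|].
    split; [|apply le_n].
    pose proof (cost_low_upp k len (scons b l) 0 V); nia.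
  - destruct (IHn m M' ltac:(lia) _ _ _ q _ _ _ _ _ _ _ _ Hm He HNs HJ) as (n' & Hn' & Hb).
    exists (S n'); split; [|subst len; simpl in *; lia].
    eapply std_head; [apply hstep_apps, hstep_fsub, Hh | exact Hn'].
Qed.

(** Lexicographic induction on [n] and [comp M]: the [Mu] form at [n] rests on the plain form at the
    same [n], which uses the [Mu] form only below [n]. *)
Lemma subst_reach_all n M : subst_reach n M /\ subst_reach_mu n M.
Proof.
  revert M; induction n as [n IHn] using (well_founded_induction lt_wf); intros M.
  enough (forall M, subst_reach n M) as HP
    by (split; [easy | apply subst_reach_mu_step; [intros; now apply IHn | easy]]).
  clear M; intros M.
  induction M as [M IHc] using (induction_ltof1 _ comp).
  apply subst_reach_step; [intros; now apply IHn | exact IHc].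
Qed.

(** * Evaluation of the cost; bounds for application, beta and mu *)

Lemma scons_const {T} (h : T) : scons h (fun _ => h) = fun _ => h.
Proof. extensionality n; now destruct n. Qed.

(** An occurrence with [i] arguments costs at most [(i + 1) * K]. There are at most [comp M]
    occurrences, and each of the at most [comp M - 1] applications supplies an argument to at most
    one of them. With the [j] outer arguments this makes [2 * comp M - 1 + j] units, the origin of
    the weight of a beta-redex. *)
Lemma cost_upp_le k K j M :
  (forall x, k x <= K) ->
  cost (upp k) (fun _ => 0) (fun _ => 0) j M + K <= (2 * comp M + j) * K.
Proof.
  revert k j; induction M; intros k j Hk; simpl comp; simpl cost.
  - unfold upp; specialize (Hk x); nia.
  - rewrite scons_upp; specialize (IHM (scons 0 k) 0).
    assert (forall x, scons 0 k x <= K) as Hk' by (intros [|x]; simpl; [lia | easy]).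
    specialize (IHM Hk'); nia.
  - rewrite scons_const; specialize (IHM k 0 Hk); nia.
  - specialize (IHM k 0 Hk); nia.
  - specialize (IHM1 k (S j) Hk); specialize (IHM2 k 0 Hk); nia.
Qed.

Lemma locc_cost_low k len l j x M : locc x M * k x <= cost (low k) len l j M.
Proof.
  revert k len l j x; induction M; intros k len l j y; simpl.
  - unfold low; destruct (Nat.eqb_spec y x); subst; lia.
  - rewrite scons_low; apply (IHM (scons 0 k)).
  - apply IHM.
  - specialize (IHM k len l (len a) y); lia.
  - specialize (IHM1 k len l (S j) y); specialize (IHM2 k len l 0 y); nia.
Qed.

Lemma cost_at_name w len l j a M :
  (forall x j, w x j = 0) -> (forall b, b <> a -> l b = 0) ->
  cost w len l j M = mocc a M * l a.
Proof.
  revert w len l j a; induction M; intros w len l j c Hw Hl; simpl.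
  - apply Hw.
  - apply IHM; [|easy]; intros [|x] i; simpl; auto.
  - change (l c) with (scons 0 l (S c)); apply IHM; [easy|].
    intros [|b] Hb; simpl; [easy | apply Hl; congruence].
  - rewrite (IHM _ _ _ _ c); [|easy..].
    destruct (Nat.eqb_spec c a); subst; [lia | rewrite (Hl a); [lia | congruence]].
  - rewrite (IHM1 _ _ _ _ c), (IHM2 _ _ _ _ c); [lia | easy..].
Qed.

(** The identity substitution satisfies the second alternative of [env_var], so the argument is not
    circular. *)
Theorem std_apps : apps_std.
Proof.
  intros M n M' Ns k Ns' H HNs.
  assert (env Var Var (fun _ => 0) no_args no_args (fun _ => 0) (length Ns)) as He.
  { split.
    - intros; apply std_refl.
    - right; intros x; now exists x.
    - intros; constructor.
    - intros; simpl; lia. }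
  destruct (proj1 (subst_reach_all n M) M' _ _ ident _ _ _ _ _ _ _ _ H He HNs (le_n _))
    as (n' & Hn' & Hb).
  rewrite !fsub_id in Hn'; exists n'; split; [easy|].
  pose proof (cost_upp_le (fun _ => 0) 0 (length Ns) M' ltac:(easy)).
  change (fun a => length (no_args a)) with (fun _ : nat => 0) in Hb; lia.
Qed.

Theorem std_beta_subst U n U' Q k Q' Ns b Ns' :
  std U n U' -> std Q k Q' -> stds Ns b Ns' ->
  exists n', std (apps (beta_subst U Q) Ns) n' (apps (beta_subst U' Q') Ns') /\
    n + locc 0 U' * k + b <= n' /\
    n' + k <= (length Ns + 1) * n + (2 * comp U' + length Ns) * k + b.
Proof.
  intros HU HQ HNs.
  assert (env (scons Q Var) (scons Q' Var) (scons k (fun _ => 0)) no_args no_args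
            (fun _ => 0) (length Ns)) as He.
  { split.
    - intros [|x]; simpl; [easy | apply std_refl].
    (* Copies of [Q] may land in head position, where the application bound is required. *)
    - left; exact std_apps.
    - intros; constructor.
    - intros; simpl; lia. }
  destruct (proj1 (subst_reach_all n U) U' _ _ ident _ _ _ _ _ _ _ _ HU He HNs (le_n _))
    as (n' & Hn' & Hb).
  rewrite !beta_subst_fsub; exists n'; split; [easy|].
  change (fun a => length (no_args a)) with (fun _ : nat => 0) in Hb.
  pose proof (cost_upp_le (scons k (fun _ => 0)) k (length Ns) U').
  pose proof (locc_cost_low (scons k (fun _ => 0)) (fun _ => 0) (fun _ => 0) (length Ns) 0 U').
  simpl in *; assert (forall x, scons k (fun _ : nat => 0) x <= k)
    by (intros [|x]; simpl; lia).
  specialize (H H1); lia.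
Qed.

(** The argument lists have length at most one, so [J + 1] is 2. Copies of [Q] are inserted as
    arguments, never at a head, so each costs exactly [k]. *)
Theorem std_rsub U n U' Q k Q' :
  std U n U' -> std Q k Q' ->
  exists n', std (rsub 0 (mren S Q) U) n' (rsub 0 (mren S Q') U') /\
    n + mocc 0 U' * k <= n' <= 2 * n + mocc 0 U' * k.
Proof.
  intros HU HQ.
  assert (env Var Var (fun _ => 0) (at_name 0 [mren S Q]) (at_name 0 [mren S Q'])
            (scons k (fun _ => 0)) 1) as He.
  { split.
    - intros; apply std_refl.
    - right; intros x; now exists x.
    - intros [|a]; unfold at_name; simpl; [|constructor].
      rewrite <- (Nat.add_0_r k); constructor; [now apply std_mren | constructor].
    - intros [|a]; simpl; auto. }
  destruct (proj1 (subst_reach_all n U) U' _ _ ident _ _ _ _ _ [] 0 [] HU He stds_nil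
             ltac:(simpl; auto)) as (n' & Hn' & Hb).
  rewrite !rsub_as_fsub; exists n'; split; [easy|].
  rewrite !(cost_at_name _ _ _ _ 0) in Hb; simpl in *; try lia.
  - intros; unfold upp; lia.
  - intros [|c]; simpl; easy.
  - easy.
  - intros [|c]; simpl; easy.
Qed.

(** * Typing and occurrences under reduction *)

Inductive args_typing (G D : list ty) : ty -> list term -> ty -> Prop :=
| args_typing_nil A : args_typing G D A [] A
| args_typing_cons A B C N Ns :
    typing G D N A -> args_typing G D B Ns C ->
    args_typing G D (Arrow A B) (N :: Ns) C.

Lemma typing_apps G D M A Ns B :
  typing G D M A -> args_typing G D A Ns B -> typing G D (apps M Ns) B.
Proof.
  intros H HNs; revert M H; induction HNs; intros M H'; simpl; eauto using typing.
Qed.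

Lemma typing_rn G D G' D' p q M A :
  typing G D M A ->
  (forall x B, nth_error G x = Some B -> nth_error G' (p x) = Some B) ->
  (forall a B, 0 < mocc a M -> nth_error D a = Some B -> nth_error D' (q a) = Some B) ->
  typing G' D' (rn p q M) A.
Proof.
  intros H; revert G' D' p q.
  induction H as [G D x A Hx | G D M A B H IH | G D M N A B HM IHM HN IHN
                 | G D a M A Ha H IH | G D M A H IH]; intros G' D' p q Hp Hq; simpl in *.
  - constructor; auto.
  - constructor; apply IH; [|easy]; intros [|x] C; simpl; auto.
  - econstructor; [apply IHM | apply IHN]; auto; intros; apply Hq; auto; lia.
  - econstructor; [apply Hq; [rewrite Nat.eqb_refl; lia | exact Ha]|].
    apply IH; auto; intros; apply Hq; auto; lia.
  - constructor; apply IH; [easy|]; intros [|b] C; simpl; auto.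
Qed.

Lemma typing_lren_S G D B M A : typing G D M A -> typing (B :: G) D (lren S M) A.
Proof. intros H; rewrite lren_rn; now apply (typing_rn G D). Qed.

Lemma typing_mren_S G D B M A : typing G D M A -> typing G (B :: D) (mren S M) A.
Proof. intros H; rewrite mren_rn; now apply (typing_rn G D). Qed.

Lemma args_typing_map G D G' D' f A Ns B :
  (forall N C, typing G D N C -> typing G' D' (f N) C) ->
  args_typing G D A Ns B -> args_typing G' D' A (map f Ns) B.
Proof. intros Hf; induction 1; simpl; constructor; auto. Qed.

(** The type declared for a name may change from [B] to [C], what is left of [B] after its
    arguments; this is how the mu-rule shortens the type of the bound name. *)
Lemma typing_fsub G D G' D' s q r M A :
  typing G D M A ->
  (forall x B, nth_error G x = Some B -> typing G' D' (s x) B) ->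
  (forall a B, nth_error D a = Some B ->
     exists C, nth_error D' (q a) = Some C /\ args_typing G' D' B (r a) C) ->
  typing G' D' (fsub s q r M) A.
Proof.
  intros H; revert G' D' s q r.
  induction H as [G D x A Hx | G D M A B H IH | G D M N A B HM IHM HN IHN
                 | G D a M A Ha H IH | G D M A H IH]; intros G' D' s q r Hs Hr; simpl.
  - auto.
  - constructor; apply IH.
    + intros [|x] C; simpl; intros E; [injection E as <-; now constructor|].
      apply typing_lren_S; auto.
    + intros a C E; destruct (Hr a C E) as (C' & E' & HC); exists C'; split; [easy|].
      eapply args_typing_map; [|exact HC]; intros; now apply typing_lren_S.
  - econstructor; eauto.
  - destruct (Hr a A Ha) as (C & E & HC); econstructor; [exact E|].
    eapply typing_apps; eauto.
  - constructor; apply IH.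
    + intros x B E; apply typing_mren_S; auto.
    + intros [|a] B; simpl; intros E; [eexists; split; [eauto | constructor]|].
      destruct (Hr a B E) as (C' & E' & HC); exists C'; split; [easy|].
      eapply args_typing_map; [|exact HC]; intros; now apply typing_mren_S.
Qed.

Lemma contract_root_cases M M' :
  contract_root M = Some M' ->
  (exists U Q, M = App (Lam U) Q /\ M' = beta_subst U Q) \/
  (exists U Q, M = App (Mu U) Q /\ M' = Mu (rsub 0 (mren S Q) U)) \/
  (exists a V, M = Name a (Mu V) /\ M' = rho_subst V a) \/
  M = Mu (Name 0 (mren S M')).
Proof.
  destruct M as [| | [| | |[|b] P|] | a [| |V| |] | [|U|U| |] Q]; simpl;
    intros E; try discriminate E.
  - destruct (mocc 0 P =? 0) eqn:E0; [|discriminate E]; injection E as <-.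
    apply Nat.eqb_eq in E0; rewrite mren_S_mlower by easy; auto.
  - injection E as <-; eauto 7.
  - injection E as <-; eauto.
  - injection E as <-; right; left; eauto.
Qed.

(** Induction over contracted positions. The form [mren S P] of a theta-redex carries the side
    condition in the shape of the term. *)
Lemma contract_elim (R : term -> term -> Prop) :
  (forall U Q, R (App (Lam U) Q) (beta_subst U Q)) ->
  (forall U Q, R (App (Mu U) Q) (Mu (rsub 0 (mren S Q) U))) ->
  (forall a V, R (Name a (Mu V)) (rho_subst V a)) ->
  (forall P, R (Mu (Name 0 (mren S P))) P) ->
  (forall M N, R M N -> R (Lam M) (Lam N)) ->
  (forall M N, R M N -> R (Mu M) (Mu N)) ->
  (forall a M N, R M N -> R (Name a M) (Name a N)) ->
  (forall M N Q, R M N -> R (App M Q) (App N Q)) ->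
  (forall M N Q, R M N -> R (App Q M) (App Q N)) ->
  forall p M N, contract p M = Some N -> R M N.
Proof.
  intros Hbeta Hmu Hrho Htheta Hl Hm Hn Hf Ha p.
  induction p as [|d p IH]; intros M N H.
  - apply contract_root_cases in H
      as [(U & Q & -> & ->) | [(U & Q & -> & ->) | [(a & V & -> & ->) | ->]]]; auto.
  - destruct d, M as [x|M|M|a M|M1 M2]; simpl in H; try discriminate H;
      match type of H with option_map _ (contract p ?M) = _ =>
        destruct (contract p M) eqn:E; [|discriminate H] end;
      injection H as <-; auto.
Qed.

Lemma contract_typing p M M' :
  contract p M = Some M' -> forall G D A, typing G D M A -> typing G D M' A.
Proof.
  revert p M M'; apply (contract_elim (fun M M' =>
    forall G D A, typing G D M A -> typing G D M' A)).
  - intros U Q G D A H; inversion H as [| | ? ? ? ? B ? HU HQ | |]; subst.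
    inversion HU; subst; rewrite beta_subst_fsub.
    eapply typing_fsub; eauto.
    + intros [|x] C; simpl; intros E; [now injection E as <-|]; now constructor.
    + intros a C E; exists C; split; [easy | constructor].
  - intros U Q G D A H; inversion H as [| | ? ? ? ? B ? HU HQ | |]; subst.
    inversion HU; subst; rewrite rsub_as_fsub; constructor.
    eapply typing_fsub; eauto.
    + intros; now constructor.
    + intros [|a] C; simpl; intros E.
      * injection E as <-; eexists; split; [reflexivity|].
        unfold at_name; simpl; econstructor; [now apply typing_mren_S | constructor].
      * exists C; split; [easy | constructor].
  - intros a V G D A H; inversion H as [| | |? ? ? ? B Ha HV |]; subst.
    inversion HV; subst; rewrite rho_subst_rn.
    eapply typing_rn; eauto; intros [|b] C _; simpl; [congruence | easy].
  - intros P G D A H; inversion H as [| | | |? ? ? ? HV]; subst.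
    inversion HV as [| | |? ? ? ? B Ha HP |]; subst; injection Ha as <-.
    rewrite <- (mlower_S P); unfold mlower; rewrite mren_rn.
    eapply typing_rn; eauto; intros [|b] C; simpl; [|easy].
    rewrite mocc_0_mren_S; lia.
  - intros M N IH G D A H; inversion H; subst; constructor; auto.
  - intros M N IH G D A H; inversion H; subst; constructor; auto.
  - intros a M N IH G D A H; inversion H; subst; econstructor; eauto.
  - intros M N Q IH G D A H; inversion H; subst; econstructor; eauto.
  - intros M N Q IH G D A H; inversion H; subst; econstructor; eauto.
Qed.

Lemma reduces_typable M s N : reduces M s N -> typable M -> typable N.
Proof.
  induction 1 as [|M p M' s N H _ IH]; [easy|].
  intros (G & D & A & HM); apply IH; exists G, D, A; eapply contract_typing; eauto.
Qed.

Lemma typable_app M N : typable (App M N) -> typable M /\ typable N.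
Proof.
  intros (G & D & A & H); inversion H; subst; split; repeat eexists; eauto.
Qed.

Lemma typable_lam M : typable (Lam M) -> typable M.
Proof. intros (G & D & A & H); inversion H; subst; repeat eexists; eauto. Qed.

Lemma typable_mu M : typable (Mu M) -> typable M.
Proof. intros (G & D & A & H); inversion H; subst; repeat eexists; eauto. Qed.

Lemma typable_name a M : typable (Name a M) -> typable M.
Proof. intros (G & D & A & H); inversion H; subst; repeat eexists; eauto. Qed.

Lemma stuck_not_typable M : stuck M -> ~ typable M.
Proof.
  induction 1 as [a M N | M N _ IH]; intros HT.
  - destruct HT as (G & D & A & H); inversion H as [| | ? ? ? ? ? ? HM | |]; inversion HM.
  - now apply typable_app in HT as [HT _].
Qed.

(** * Free occurrences and lambda-mu-I-terms *)

Lemma locc_lren p x M :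
  (forall y, p y = p x -> y = x) -> locc (p x) (lren p M) = locc x M.
Proof.
  revert p x; induction M as [y|M IH|M IH|a M IH|M IHM N IHN]; intros p x H; simpl; auto.
  - destruct (Nat.eqb_spec (p x) (p y)) as [E|E], (Nat.eqb_spec x y) as [E'|E'];
      try easy; exfalso; [apply E'; symmetry; auto | congruence].
  - change (S (p x)) with (upren p (S x)); apply IH.
    intros [|y]; simpl; intros E; [easy|]; f_equal; apply H; congruence.
Qed.

Lemma locc_lren_S x M : locc (S x) (lren S M) = locc x M.
Proof. apply locc_lren; intros; congruence. Qed.

Lemma mocc_mren_S a M : mocc (S a) (mren S M) = mocc a M.
Proof. apply mocc_mren; intros; congruence. Qed.

Lemma locc_mren q x M : locc x (mren q M) = locc x M.
Proof. revert q x; induction M; intros; simpl; auto. Qed.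

Lemma mocc_lren p a M : mocc a (lren p M) = mocc a M.
Proof. revert p a; induction M; intros; simpl; auto. Qed.

Lemma locc_apps x M Ns :
  0 < locc x (apps M Ns) <-> 0 < locc x M \/ exists N, In N Ns /\ 0 < locc x N.
Proof.
  revert M; induction Ns as [|N Ns IH]; intros M; simpl.
  - firstorder.
  - rewrite IH; simpl; split.
    + intros [H | (N' & ? & ?)]; [|eauto].
      destruct (locc x M) eqn:E; [right; exists N; split; [auto | lia] | left; lia].
    + intros [H | (N' & [-> | ?] & ?)]; [left; lia | left; lia | eauto].
Qed.

Lemma mocc_apps a M Ns :
  0 < mocc a (apps M Ns) <-> 0 < mocc a M \/ exists N, In N Ns /\ 0 < mocc a N.
Proof.
  revert M; induction Ns as [|N Ns IH]; intros M; simpl.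
  - firstorder.
  - rewrite IH; simpl; split.
    + intros [H | (N' & ? & ?)]; [|eauto].
      destruct (mocc a M) eqn:E; [right; exists N; split; [auto | lia] | left; lia].
    + intros [H | (N' & [-> | ?] & ?)]; [left; lia | left; lia | eauto].
Qed.

Lemma locc_fsub x s q r M :
  0 < locc x (fsub s q r M) <->
  (exists y, 0 < locc y M /\ 0 < locc x (s y)) \/
  (exists a N, 0 < mocc a M /\ In N (r a) /\ 0 < locc x N).
Proof.
  revert x s q r; induction M as [y|M IH|M IH|a M IH|M IHM N IHN]; intros x s q r; simpl.
  - split.
    + intros H; left; exists y; rewrite Nat.eqb_refl; split; [lia | easy].
    + intros [(z & Hz & H) | (a & N & Hz & _)]; [|lia].
      destruct (Nat.eqb_spec z y); [now subst | lia].
  - rewrite IH; split.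
    + intros [([|y] & Hy & H) | (a & N & Ha & HN & H)].
      * simpl in H; lia.
      * left; exists y; simpl in H; rewrite locc_lren_S in H; easy.
      * apply in_map_iff in HN as (N' & <- & HN); rewrite locc_lren_S in H; eauto 6.
    + intros [(y & Hy & H) | (a & N & Ha & HN & H)].
      * left; exists (S y); simpl; now rewrite locc_lren_S.
      * right; exists a, (lren S N); rewrite locc_lren_S; auto using in_map.
  - rewrite IH; split.
    + intros [(y & Hy & H) | ([|a] & N & Ha & HN & H)]; [|easy|].
      * left; exists y; now rewrite locc_mren in H.
      * apply in_map_iff in HN as (N' & <- & HN); rewrite locc_mren in H; eauto 6.
    + intros [(y & Hy & H) | (a & N & Ha & HN & H)].
      * left; exists y; now rewrite locc_mren.
      * right; exists (S a), (mren S N); rewrite locc_mren; split; [easy|].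
        simpl; auto using in_map.
  - rewrite locc_apps, IH; split.
    + intros [[(y & Hy & H) | (b & N & Hb & HN & H)] | (N & HN & H)]; [eauto | |].
      * right; exists b, N; split; [lia | easy].
      * right; exists a, N; rewrite Nat.eqb_refl; split; [lia | easy].
    + intros [H | (b & N & Hb & HN & H)]; [eauto|].
      destruct (Nat.eqb_spec b a) as [->|]; eauto 7.
  - transitivity (0 < locc x (fsub s q r M) \/ 0 < locc x (fsub s q r N)); [lia|].
    rewrite IHM, IHN; split.
    + intros [[(y & Hy & H) | (b & Q & Hb & HN & H)] | [(y & Hy & H) | (b & Q & Hb & HN & H)]];
        ((left; exists y) || (right; exists b, Q)); split; (lia || easy).
    + intros [(y & Hy & H) | (b & Q & Hb & HN & H)].
      * destruct (locc y M) eqn:E; [right | left]; left; exists y; split; (lia || easy).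
      * destruct (mocc b M) eqn:E; [right | left]; right; exists b, Q; split; (lia || easy).
Qed.

Lemma mocc_fsub c s q r M :
  0 < mocc c (fsub s q r M) <->
  (exists y, 0 < locc y M /\ 0 < mocc c (s y)) \/
  (exists a, 0 < mocc a M /\ (q a = c \/ exists N, In N (r a) /\ 0 < mocc c N)).
Proof.
  revert c s q r; induction M as [y|M IH|M IH|a M IH|M IHM N IHN]; intros c s q r; simpl.
  - split.
    + intros H; left; exists y; rewrite Nat.eqb_refl; split; [lia | easy].
    + intros [(z & Hz & H) | (a & Hz & _)]; [|lia].
      destruct (Nat.eqb_spec z y); [now subst | lia].
  - rewrite IH; split.
    + intros [([|y] & Hy & H) | (a & Ha & [H | (N & HN & H)])].
      * simpl in H; lia.
      * left; exists y; simpl in H; rewrite mocc_lren in H; easy.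
      * eauto 8.
      * apply in_map_iff in HN as (N' & <- & HN); rewrite mocc_lren in H; eauto 9.
    + intros [(y & Hy & H) | (a & Ha & [H | (N & HN & H)])].
      * left; exists (S y); simpl; now rewrite mocc_lren.
      * eauto 8.
      * right; exists a; split; [easy | right]; exists (lren S N); rewrite mocc_lren;
          auto using in_map.
  - rewrite IH; split.
    + intros [(y & Hy & H) | ([|a] & Ha & [H | (N & HN & H)])]; try easy.
      * left; exists y; now rewrite mocc_mren_S in H.
      * simpl in H; right; exists a; split; [easy | left; congruence].
      * apply in_map_iff in HN as (N' & <- & HN); rewrite mocc_mren_S in H; eauto 9.
    + intros [(y & Hy & H) | (a & Ha & [H | (N & HN & H)])].
      * left; exists y; now rewrite mocc_mren_S.
      * right; exists (S a); split; [easy | left; simpl; congruence].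
      * right; exists (S a); split; [easy | right]; exists (mren S N);
          rewrite mocc_mren_S; simpl; auto using in_map.
  - transitivity (c = q a \/ 0 < mocc c (apps (fsub s q r M) (r a))).
    { destruct (Nat.eqb_spec c (q a)); split; (lia || tauto). }
    rewrite mocc_apps, IH; split.
    + intros [-> | [[(y & Hy & H) | (b & Hb & H)] | (N & HN & H)]]; [| eauto | |].
      * right; exists a; rewrite Nat.eqb_refl; split; [lia | auto].
      * right; exists b; split; [lia | easy].
      * right; exists a; rewrite Nat.eqb_refl; split; [lia | eauto].
    + intros [H | (b & Hb & H)]; [tauto|].
      destruct (Nat.eqb_spec b a) as [E|E];
        [subst b | right; left; right; exists b; split; [lia | easy]].
      destruct H as [<- | H]; auto.
  - transitivity (0 < mocc c (fsub s q r M) \/ 0 < mocc c (fsub s q r N)); [lia|].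
    rewrite IHM, IHN; split.
    + intros [[(y & Hy & H) | (b & Hb & H)] | [(y & Hy & H) | (b & Hb & H)]];
        ((left; exists y) || (right; exists b)); split; (lia || easy).
    + intros [(y & Hy & H) | (b & Hb & H)].
      * destruct (locc y M) eqn:E; [right | left]; left; exists y; split; (lia || easy).
      * destruct (mocc b M) eqn:E; [right | left]; right; exists b; split; (lia || easy).
Qed.

(** Serves to see that the reducts of [mren S P] still avoid the name 0. *)
Lemma contract_mocc_le p M M' c :
  contract p M = Some M' -> 0 < mocc c M' -> 0 < mocc c M.
Proof.
  intros H; revert c; revert p M M' H.
  apply (contract_elim (fun M M' => forall c, 0 < mocc c M' -> 0 < mocc c M)); simpl.
  - intros U Q c; rewrite beta_subst_fsub, mocc_fsub.
    intros [([|y] & Hy & H) | (a & Ha & [<- | (N & [] & _)])]; simpl in *; unfold ident in *; lia.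
  - intros U Q c; rewrite rsub_as_fsub, mocc_fsub.
    intros [(y & Hy & H) | ([|a] & Ha & [E | (N & HN & H)])]; simpl in *; unfold ident in *;
      try lia; try easy.
    + destruct HN as [<- | []]; rewrite mocc_mren_S in H; lia.
    + injection E as <-; lia.
  - intros a V c; rewrite rho_subst_rn, rn_as_fsub, mocc_fsub.
    intros [(y & Hy & H) | ([|b] & Hb & [<- | (N & [] & _)])]; simpl in *; unfold ident in *;
      try lia.
    rewrite Nat.eqb_refl; lia.
  - intros P c; rewrite mocc_mren_S; lia.
  - auto.
  - auto.
  - intros a M N IH c H; specialize (IH c); lia.
  - intros M N Q IH c H; specialize (IH c); lia.
  - intros M N Q IH c H; specialize (IH c); lia.
Qed.

Lemma reduces_mocc_0 M s N c : reduces M s N -> mocc c M = 0 -> mocc c N = 0.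
Proof.
  induction 1 as [|M p M' s N H _ IH]; [easy|]; intros H0; apply IH.
  pose proof (contract_mocc_le p M M' c H); lia.
Qed.

Lemma lmI_apps M Ns : lambda_mu_I M -> Forall lambda_mu_I Ns -> lambda_mu_I (apps M Ns).
Proof.
  intros H HNs; revert M H; induction HNs; intros M HM; simpl; auto using lambda_mu_I.
Qed.

Lemma lmI_rn p q M : lambda_mu_I M -> lambda_mu_I (rn p q M).
Proof.
  intros H; revert p q; induction H; intros p q; simpl; constructor; auto.
  - rewrite rn_as_fsub; apply locc_fsub; left; exists 0; simpl; auto.
  - rewrite rn_as_fsub; apply mocc_fsub; right; exists 0; simpl; auto.
Qed.

Lemma lmI_mren q M : lambda_mu_I M -> lambda_mu_I (mren q M).
Proof. rewrite mren_rn; apply lmI_rn. Qed.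

Lemma lmI_fsub s q r M :
  lambda_mu_I M -> (forall x, lambda_mu_I (s x)) ->
  (forall a, Forall lambda_mu_I (r a)) -> lambda_mu_I (fsub s q r M).
Proof.
  intros H; revert s q r; induction H; intros s q r Hs Hr; simpl.
  - auto.
  - constructor; auto.
  - constructor; apply lmI_apps; auto.
  - constructor.
    + apply IHlambda_mu_I.
      * intros [|x]; simpl; [constructor | rewrite lren_rn; now apply lmI_rn].
      * intros a; apply Forall_map; eapply Forall_impl; [|apply Hr].
        intros N; rewrite lren_rn; apply lmI_rn.
    + apply locc_fsub; left; exists 0; simpl; auto.
  - constructor.
    + apply IHlambda_mu_I.
      * intros x; now apply lmI_mren.
      * intros [|a]; [constructor|].
        apply Forall_map; eapply Forall_impl; [|apply Hr]; intros N; apply lmI_mren.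
    + apply mocc_fsub; right; exists 0; simpl; auto.
Qed.

(** Closure and persistence of free variables and names are proved together, since persistence keeps
    the binders above the redex from becoming void. *)
Lemma contract_lmI p M M' :
  contract p M = Some M' -> lambda_mu_I M ->
  lambda_mu_I M' /\ (forall x, 0 < locc x M -> 0 < locc x M') /\
  (forall a, 0 < mocc a M -> 0 < mocc a M').
Proof.
  revert p M M'.
  apply (contract_elim (fun M M' => lambda_mu_I M -> lambda_mu_I M' /\
    (forall x, 0 < locc x M -> 0 < locc x M') /\ (forall a, 0 < mocc a M -> 0 < mocc a M')));
    simpl.
  - intros U Q H; inversion H as [|? ? HU HQ| | |]; inversion HU; subst.
    rewrite beta_subst_fsub; split; [|split].
    + apply lmI_fsub; [easy | intros [|x]; simpl; [easy | constructor] | constructor].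
    + intros x Hx; apply locc_fsub; left.
      destruct (locc (S x) U) eqn:E; [exists 0; simpl; split; [easy | lia]|].
      exists (S x); simpl; rewrite Nat.eqb_refl; split; lia.
    + intros a Ha; apply mocc_fsub.
      destruct (mocc a U) eqn:E; [left; exists 0; simpl; split; [easy | lia]|].
      right; exists a; split; [lia | now left].
  - intros U Q H; inversion H as [|? ? HU HQ| | |]; inversion HU; subst.
    rewrite rsub_as_fsub; split; [|split].
    + constructor.
      * apply lmI_fsub; [easy | intros; constructor|].
        intros [|a]; unfold at_name; simpl; repeat constructor; now apply lmI_mren.
      * apply mocc_fsub; right; exists 0; split; [easy | now left].
    + intros x Hx; apply locc_fsub.
      destruct (locc x U) eqn:E.
      * right; exists 0, (mren S Q); rewrite locc_mren; simpl; repeat split; [easy | auto | lia].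
      * left; exists x; simpl; rewrite Nat.eqb_refl; lia.
    + intros a Ha; apply mocc_fsub; right.
      destruct (mocc (S a) U) eqn:E.
      * exists 0; split; [easy | right]; exists (mren S Q); rewrite mocc_mren_S; simpl;
          split; [auto | lia].
      * exists (S a); split; [lia | now left].
  - intros a V H; inversion H as [| |? ? HV| |]; inversion HV; subst.
    rewrite rho_subst_rn; split; [now apply lmI_rn | rewrite rn_as_fsub; split].
    + intros x Hx; apply locc_fsub; left; exists x; simpl; unfold ident;
        rewrite Nat.eqb_refl; lia.
    + intros b Hb; apply mocc_fsub; right.
      destruct (Nat.eqb_spec b a) as [E|E]; [exists 0 | exists (S b)]; split; auto; now left.
  - intros P H; inversion H as [| | | |? HN _]; inversion HN as [| |? ? HP| |]; subst.
    split; [|split].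
    + rewrite <- (mlower_S P); now apply lmI_mren.
    + intros x; now rewrite locc_mren.
    + intros a; now rewrite mocc_mren_S.
  - intros M N IH H; inversion H; subst; destruct IH as (? & ? & ?); [easy|].
    repeat split; auto; constructor; auto.
  - intros M N IH H; inversion H; subst; destruct IH as (? & ? & ?); [easy|].
    repeat split; auto; constructor; auto.
  - intros a M N IH H; inversion H; subst; destruct IH as (? & ? & Hm); [easy|].
    repeat split; auto; [now constructor|].
    intros b Hb; specialize (Hm b); lia.
  - intros M N Q IH H; inversion H; subst; destruct IH as (? & Hl & Hm); [easy|].
    repeat split; [now constructor | intros x Hx; specialize (Hl x); lia
      | intros a Ha; specialize (Hm a); lia].
  - intros M N Q IH H; inversion H; subst; destruct IH as (? & Hl & Hm); [easy|].
    repeat split; [now constructor | intros x Hx; specialize (Hl x); lia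
      | intros a Ha; specialize (Hm a); lia].
Qed.

Lemma reduces_lmI M s N : reduces M s N -> lambda_mu_I M -> lambda_mu_I N.
Proof.
  induction 1 as [|M p M' s N H _ IH]; [easy|]; intros HM.
  now apply IH, (contract_lmI p M).
Qed.

(** * Realisation by standard sequences *)

Lemma reduces_app M s s' N :
  reduces M (s ++ s') N <-> exists P, reduces M s P /\ reduces P s' N.
Proof.
  split.
  - revert M; induction s as [|p s IH]; intros M H; simpl in H.
    + exists M; split; [constructor | easy].
    + inversion H as [|? ? M' ? ? E H']; subst; apply IH in H' as (P & HP & H').
      exists P; split; [econstructor; eauto | easy].
  - intros (P & H & H'); induction H; simpl; [easy | econstructor; eauto].
Qed.

Lemma reduces_fun M s N N' : reduces M s N -> reduces M s N' -> N = N'.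
Proof.
  intros H; revert N'; induction H as [M|M p M' s N E H IH]; intros N' H'.
  - now inversion H'.
  - inversion H' as [|? ? M'' ? ? E' H'']; subst; apply IH; congruence.
Qed.

(** A context is described by its effect on [contract] alone, so that [apps] with a hole at its head
    is treated like a constructor. *)
Definition hole (q : pos) (C : term -> term) : Prop :=
  forall p M, contract (q ++ p) (C M) = option_map C (contract p M).

Lemma hole_app q C q' C' :
  hole q C -> hole q' C' -> hole (q ++ q') (fun M => C (C' M)).
Proof.
  intros H H' p M; rewrite <- app_assoc, H, H'; now destruct (contract p M).
Qed.

Lemma hole_args Ms : hole (repeat Fun (length Ms)) (fun M => apps M Ms).
Proof.
  induction Ms as [|A Ms IH] using rev_ind; intros p M.
  - simpl; now destruct (contract p M).
  - rewrite length_app, Nat.add_comm; simpl. rewrite !apps_app; simpl; rewrite IH.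
    destruct (contract p M); simpl; [now rewrite apps_app | easy].
Qed.

Lemma hole_reduces q C M s N :
  hole q C -> reduces M s N -> reduces (C M) (at_ q s) (C N).
Proof.
  intros HC; induction 1 as [|M p M' s N E H IH]; simpl; [constructor|].
  econstructor; [rewrite HC, E; reflexivity | exact IH].
Qed.

Lemma hole_reduces_inv q C M s X :
  hole q C -> reduces (C M) (at_ q s) X -> exists N, X = C N /\ reduces M s N.
Proof.
  intros HC; revert M; induction s as [|p s IH]; intros M H; simpl in H;
    inversion H as [|? ? M' ? ? E H']; subst.
  - exists M; split; [easy | constructor].
  - rewrite HC in E; destruct (contract p M) as [M1|] eqn:E1; [|discriminate E].
    injection E as <-; apply IH in H' as (N & -> & H'); exists N; split; [easy|].
    econstructor; eauto.
Qed.

(** All prefixes are standard and all suffixes are in [std]. *)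
Definition good (M : term) (s : list pos) (N : term) : Prop :=
  reduces M s N /\
  forall s1 s2 P, s = s1 ++ s2 -> reduces M s1 P ->
    standard M s1 P /\ std P (length s2) N.

Lemma good_reduces M s N : good M s N -> reduces M s N.
Proof. now intros []. Qed.

Lemma good_standard M s N : good M s N -> standard M s N.
Proof.
  intros [H H']; apply (H' s [] N); [now rewrite app_nil_r | easy].
Qed.

Lemma good_std M s N : good M s N -> std M (length s) N.
Proof. intros [H H']; apply (H' [] s M); [easy | constructor]. Qed.

Lemma app_eq_cases {T} (a b c d : list T) :
  a ++ b = c ++ d ->
  (exists e, e <> [] /\ a = c ++ e /\ d = e ++ b) \/ (exists e, c = a ++ e /\ b = e ++ d).
Proof.
  intros H; apply app_eq_app in H as (e & [[-> ->] | [-> ->]]); [|eauto].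
  destruct e; [right; exists []; now rewrite !app_nil_r | left; eexists; split; [|eauto]; easy].
Qed.

(** A prefix stopping strictly before [H] has met no [bad] term and falls under the clause that
    keeps the constructor. Any longer prefix contains all of [s1] and is left to the hypothesis on
    [r]. *)
Lemma good_hit (bad : term -> Prop) C M s1 H r N :
  hole [Body] C ->
  (forall s Q, standard M s Q -> never bad (C M) (at_ [Body] s) ->
     standard (C M) (at_ [Body] s) (C Q)) ->
  reduces M s1 H ->
  (forall a b X, s1 = a ++ b -> b <> [] -> reduces M a X ->
     standard M a X /\ ~ bad (C X) /\ std (C X) (length b + length r) N) ->
  reduces (C H) r N ->
  (forall r1 r2 X, r = r1 ++ r2 -> reduces (C H) r1 X ->
     standard (C M) (at_ [Body] s1 ++ r1) X /\ std X (length r2) N) ->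
  good (C M) (at_ [Body] s1 ++ r) N.
Proof.
  intros HC Hkeep H1 Hpre Hr Htail; split.
  - apply reduces_app; exists (C H); split; [now apply hole_reduces | easy].
  - intros t1 t2 P E HP; apply app_eq_cases in E as [(e & He & E & ->) | (e & -> & ->)].
    + unfold at_ in E; apply map_eq_app in E as (a & b & -> & <- & <-).
      apply (hole_reduces_inv _ C) in HP as (X & -> & HX); [|exact HC].
      destruct (Hpre a b X eq_refl) as (Hst & _ & Hstd); [now intros ->| easy |].
      split; [|rewrite length_app, length_map; exact Hstd].
      apply Hkeep; [easy|]; intros u1 u2 Q E HQ.
      unfold at_ in E; apply map_eq_app in E as (u & v & -> & <- & <-).
      apply (hole_reduces_inv _ C) in HQ as (Y & -> & HY); [|exact HC].
      apply (Hpre u (v ++ b) Y); [now rewrite app_assoc | | easy].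
      intros E'; apply app_eq_nil in E' as [_ ->]; now apply He.
    + apply Htail; [easy|].
      apply reduces_app in HP as (Q & HQ & HP).
      apply (hole_reduces_inv _ C) in HQ as (Y & -> & HY); [|exact HC].
      now rewrite (reduces_fun _ _ _ _ H1 HY).
Qed.

Lemma first_hit (bad : term -> Prop) M s N :
  (forall X, bad X \/ ~ bad X) -> reduces M s N ->
  (forall a b X, s = a ++ b -> reduces M a X -> ~ bad X) \/
  exists s1 s2 H, s = s1 ++ s2 /\ reduces M s1 H /\ bad H /\
    forall a b X, s1 = a ++ b -> b <> [] -> reduces M a X -> ~ bad X.
Proof.
  intros Hdec; induction 1 as [M|M p M' s N E H IH].
  - destruct (Hdec M) as [HM | HM].
    + right; exists [], [], M; repeat split; [constructor | easy |].
      intros a b X E; symmetry in E; now apply app_eq_nil in E as [_ ->].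
    + left; intros a b X E; symmetry in E; apply app_eq_nil in E as [-> _].
      intros HX; now inversion HX; subst.
  - destruct (Hdec M) as [HM | HM].
    + right; exists [], (p :: s), M; repeat split; [constructor | easy |].
      intros a b X E'; symmetry in E'; now apply app_eq_nil in E' as [_ ->].
    + destruct IH as [IH | (s1 & s2 & K & -> & HK & HbK & IH)]; [left | right].
      * intros [|p' a] b X E' HX; simpl in E'; [now inversion HX; subst|].
        injection E' as <- ->; inversion HX as [|? ? M'' ? ? E'' HX']; subst.
        rewrite E in E''; injection E'' as <-; eauto.
      * exists (p :: s1), s2, K; repeat split; [econstructor; eauto | easy |].
        intros [|p' a] b X E' Hb HX; simpl in E'; [now inversion HX; subst|].
        injection E' as <- ->; inversion HX as [|? ? M'' ? ? E'' HX']; subst.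
        rewrite E in E''; injection E'' as <-; eauto.
Qed.

Lemma theta_redex_dec M : theta_redex M \/ ~ theta_redex M.
Proof.
  destruct M as [| |[| | |[|a] P|]| |];
    try (right; intros (P' & E & _); discriminate E).
  destruct (Nat.eq_dec (mocc 0 P) 0) as [E|E]; [left; now exists P | right].
  intros (P' & E' & H); injection E' as <-; easy.
Qed.

Lemma rho_redex_dec M : rho_redex M \/ ~ rho_redex M.
Proof.
  destruct M as [| | |a [| |P| |]|];
    try (right; intros (a' & P' & E); discriminate E).
  left; now exists a, P.
Qed.

Lemma hole_lam : hole [Body] Lam.
Proof. easy. Qed.

Lemma hole_mu : hole [Body] Mu.
Proof. easy. Qed.

Lemma hole_name a : hole [Body] (Name a).
Proof. easy. Qed.

Lemma hole_arg M : hole [Arg] (App M).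
Proof. easy. Qed.

Lemma never_before_end_hole bad C M s :
  hole [Body] C ->
  (forall a b X, s = a ++ b -> b <> [] -> reduces M a X -> ~ bad (C X)) ->
  never_before_end bad (C M) (at_ [Body] s).
Proof.
  intros HC H s1 p s2 P E HP.
  unfold at_ in E; apply map_eq_app in E as (a & b & -> & <- & E).
  apply (hole_reduces_inv _ C) in HP as (X & -> & HX); [|exact HC].
  apply (H a b X); [easy | now intros -> | easy].
Qed.

Lemma never_hole bad C M s :
  hole [Body] C ->
  (forall a b X, s = a ++ b -> reduces M a X -> ~ bad (C X)) ->
  never bad (C M) (at_ [Body] s).
Proof.
  intros HC H s1 s2 P E HP.
  unfold at_ in E; apply map_eq_app in E as (a & b & -> & <- & E).
  apply (hole_reduces_inv _ C) in HP as (X & -> & HX); [|exact HC].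
  now apply (H a b X).
Qed.

Lemma good_never bad C M s N :
  hole [Body] C ->
  (forall s Q, standard M s Q -> never bad (C M) (at_ [Body] s) ->
     standard (C M) (at_ [Body] s) (C Q)) ->
  (forall P n, std P n N -> std (C P) n (C N)) ->
  good M s N ->
  (forall a b X, s = a ++ b -> reduces M a X -> ~ bad (C X)) ->
  good (C M) (at_ [Body] s) (C N).
Proof.
  intros HC Hkeep Hstd HG Hn; rewrite <- (app_nil_r (at_ _ _)).
  destruct HG as [Hred HG].
  apply (good_hit bad) with (H := N); auto.
  - intros a b X E _ HX; destruct (HG a b X E HX); split; [easy|]; split; [eauto|].
    rewrite Nat.add_0_r; auto.
  - constructor.
  - intros r1 r2 X E HX; symmetry in E; apply app_eq_nil in E as [-> ->].
    inversion HX; subst; rewrite app_nil_r; split; [|apply std_refl].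
    apply Hkeep; [|now apply never_hole].
    apply (HG s []); [now rewrite app_nil_r | easy].
Qed.

Lemma good_head p M M' s N :
  contract p M = Some M' ->
  (forall s N, standard M' s N -> standard M (p :: s) N) ->
  (forall n N, std M' n N -> std M (S n) N) ->
  good M' s N -> good M (p :: s) N.
Proof.
  intros E Hst Hstd HG; split; [econstructor; [exact E | apply HG]|].
  intros [|p' s1] s2 P Es HP; simpl in Es.
  - subst; inversion HP; subst; split; [constructor|].
    simpl; now apply Hstd, good_std.
  - injection Es as <- ->; inversion HP as [|? ? M'' ? ? E' HP']; subst.
    rewrite E in E'; injection E' as <-.
    destruct HG as [_ HG]; destruct (HG s1 s2 P eq_refl HP'); auto.
Qed.

(** Positions in the arguments depend only on what stands to their right, so one sequence serves
    every head [H], in particular a head that has been reduced before. *)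
Definition good_args (Ms : list term) (s : list pos) (Ns : list term) : Prop :=
  (forall H, reduces (apps H Ms) s (apps H Ns)) /\ stds Ms (length s) Ns /\
  forall s1 s2, s = s1 ++ s2 -> exists Ps,
    (forall H, reduces (apps H Ms) s1 (apps H Ps)) /\
    standard_args Ms s1 Ps /\ stds Ps (length s2) Ns.

Lemma standard_args_nil_seq Ms : standard_args Ms [] Ms.
Proof.
  induction Ms as [|M Ms IH]; [constructor|].
  apply (standard_args_cons M Ms [] M [] Ms); [constructor | easy].
Qed.

Lemma reduces_split M s1 s2 N :
  reduces M (s1 ++ s2) N -> exists P, reduces M s1 P.
Proof. rewrite reduces_app; intros (P & H & _); eauto. Qed.

Lemma good_args_cons M t N Ms s Ns :
  good M t N -> good_args Ms s Ns ->
  good_args (M :: Ms) (at_ (repeat Fun (length Ms) ++ [Arg]) t ++ s) (N :: Ns).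
Proof.
  intros HG (Hred & HS & HA).
  assert (forall H, hole (repeat Fun (length Ms) ++ [Arg]) (fun X => apps (App H X) Ms))
    as Hh by (intros H; apply (hole_app _ _ [Arg] (App H) (hole_args Ms) (hole_arg H))).
  split; [|split].
  - intros H; apply reduces_app; exists (apps (App H N) Ms); split; [|apply Hred].
    simpl; exact (hole_reduces _ (fun X => apps (App H X) Ms) _ _ _ (Hh H) (good_reduces _ _ _ HG)).
  - unfold at_; rewrite length_app, length_map; constructor; [now apply good_std | easy].
  - intros s1 s2 E; apply app_eq_cases in E as [(e & He & E & ->) | (e & -> & ->)].
    + unfold at_ in E; apply map_eq_app in E as (a & b & -> & <- & <-).
      destruct (reduces_split _ _ _ _ (good_reduces _ _ _ HG)) as (P & HP).
      destruct HG as [_ HG]; destruct (HG a b P eq_refl HP) as [Hst Hstd].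
      exists (P :: Ms); split; [|split].
      * intros H; simpl; exact (hole_reduces _ (fun X => apps (App H X) Ms) _ _ _ (Hh H) HP).
      * rewrite <- (app_nil_r (map _ a)); constructor; [easy | apply standard_args_nil_seq].
      * rewrite length_app, length_map; now constructor.
    + destruct (HA e s2 eq_refl) as (Ps & HPs & Hst & Hstd).
      exists (N :: Ps); split; [|split].
      * intros H; apply reduces_app; exists (apps (App H N) Ms); split; [|apply HPs].
        simpl; exact (hole_reduces _ (fun X => apps (App H X) Ms) _ _ _
          (Hh H) (good_reduces _ _ _ HG)).
      * constructor; [now apply good_standard | easy].
      * apply (stds_cons N 0 N); [apply std_refl | easy].
Qed.

Lemma at_app q q' s : at_ (q ++ q') s = at_ q (at_ q' s).
Proof. unfold at_; rewrite map_map; apply map_ext; intros; now rewrite app_assoc. Qed.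

Lemma good_spine C M t N Ms s Ns :
  hole [Body] C ->
  (forall t P s Ps, standard M t P -> standard_args Ms s Ps ->
     standard (apps (C M) Ms) (at_ (repeat Fun (length Ms) ++ [Body]) t ++ s)
       (apps (C P) Ps)) ->
  (forall P n, std P n N -> spine (C P) n (C N)) ->
  good M t N -> good_args Ms s Ns ->
  good (apps (C M) Ms) (at_ (repeat Fun (length Ms) ++ [Body]) t ++ s)
    (apps (C N) Ns).
Proof.
  intros HC Hst Hsp HG (Hred & HS & HA).
  pose proof (hole_app _ _ _ _ (hole_args Ms) HC) as Hh.
  assert (reduces (apps (C M) Ms) (at_ (repeat Fun (length Ms) ++ [Body]) t)
            (apps (C N) Ms)) as Hr
    by exact (hole_reduces _ _ _ _ _ Hh (good_reduces _ _ _ HG)).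
  split.
  - apply reduces_app; eexists; split; [exact Hr | apply Hred].
  - intros s1 s2 P E HP; apply app_eq_cases in E as [(e & He & E & ->) | (e & -> & ->)].
    + unfold at_ in E; apply map_eq_app in E as (a & b & -> & <- & <-).
      apply (hole_reduces_inv _ _ _ _ _ Hh) in HP as (X & -> & HX).
      destruct HG as [_ HG]; destruct (HG a b X eq_refl HX) as [HX' HX''].
      split.
      * rewrite <- (app_nil_r (map _ a)); apply Hst; [easy | apply standard_args_nil_seq].
      * rewrite length_app, length_map; apply std_spine, spine_apps; auto.
    + destruct (HA e s2 eq_refl) as (Ps & HPs & Hsta & Hstd).
      apply reduces_app in HP as (Q & HQ & HP).
      rewrite <- (reduces_fun _ _ _ _ Hr HQ) in HP.
      rewrite <- (reduces_fun _ _ _ _ (HPs (C N)) HP).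
      split; [apply Hst; [now apply good_standard | easy]|].
      apply std_spine; rewrite <- (Nat.add_0_l (length s2)).
      apply spine_apps; [apply Hsp, std_refl | easy].
Qed.

Lemma good_var_args x Ms s Ns :
  good_args Ms s Ns -> good (apps (Var x) Ms) s (apps (Var x) Ns).
Proof.
  intros (Hred & HS & HA); split; [apply Hred|].
  intros s1 s2 P E HP; destruct (HA s1 s2 E) as (Ps & HPs & Hsta & Hstd).
  rewrite <- (reduces_fun _ _ _ _ (HPs (Var x)) HP); split; [now constructor|].
  apply std_spine; rewrite <- (Nat.add_0_l (length s2)); now apply spine_apps.
Qed.

Lemma standard_lam_spine M t P Ms s Ps :
  standard M t P -> standard_args Ms s Ps ->
  standard (apps (Lam M) Ms) (at_ (repeat Fun (length Ms) ++ [Body]) t ++ s)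
    (apps (Lam P) Ps).
Proof.
  intros H Hs; destruct Ms as [|A Ms].
  - inversion Hs; subst; rewrite app_nil_r; now constructor.
  - rewrite at_app; apply standard_lam_args; [easy | now constructor | easy].
Qed.

Lemma hstep_inv M M' :
  hstep M M' ->
  exists Ms : list term, contract (repeat Fun (length Ms)) M = Some M' /\
    forall s N, standard M' s N -> standard M (repeat Fun (length Ms) :: s) N.
Proof.
  intros H.
  assert (exists U Q Ms, (M = apps (Lam U) (Q :: Ms) /\ M' = apps (beta_subst U Q) Ms) \/
     (M = apps (Mu U) (Q :: Ms) /\ M' = apps (Mu (rsub 0 (mren S Q) U)) Ms))
    as (U & Q & Ms & [[-> ->] | [-> ->]]).
  { induction H as [U Q | U Q | M M' N _ (U & Q & Ms & [[-> ->] | [-> ->]])].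
    - exists U, Q, []; auto.
    - exists U, Q, []; auto.
    - exists U, Q, (Ms ++ [N]); left; now rewrite app_comm_cons, !apps_app.
    - exists U, Q, (Ms ++ [N]); right; now rewrite app_comm_cons, !apps_app. }
  - exists Ms; split; [|intros; now apply standard_beta].
    rewrite <- (app_nil_r (repeat _ _)); simpl; now rewrite (hole_args Ms [] (App (Lam U) Q)).
  - exists Ms; split; [|intros; now apply standard_mu_app].
    rewrite <- (app_nil_r (repeat _ _)); simpl; now rewrite (hole_args Ms [] (App (Mu U) Q)).
Qed.

(** * Cutting at the first theta- or rho-redex *)

Lemma std_mlower M n N : std (mren S M) n (mren S N) -> std M n N.
Proof.
  intros H; apply (std_mren pred) in H.
  now rewrite !(mlower_S : forall M, mren pred (mren S M) = M) in H.
Qed.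

(** [mu a.[a]mu b.V] contracts to [mu b.V] by theta and to [mu a.V[b := a]] by rho. *)
Lemma mlower_mu_rho V : mocc 1 V = 0 -> mlower (Mu V) = Mu (rho_subst V 0).
Proof.
  intros H; unfold mlower, rho_subst; simpl; f_equal; apply mren_occ_ext.
  intros [|[|a]] Ha; simpl; [easy | lia | easy].
Qed.

Lemma length_at q s : length (at_ q s) = length s.
Proof. apply length_map. Qed.

Record hit (bad : term -> Prop) (C : term -> term) (M : term) (s1 : list pos)
    (H : term) (s2 : list pos) (N : term) : Prop := {
  hit_hole : hole [Body] C;
  hit_keep : forall s Q, standard M s Q -> never bad (C M) (at_ [Body] s) ->
    standard (C M) (at_ [Body] s) (C Q);
  hit_good : good M (s1 ++ s2) N;
  hit_reduces : reduces M s1 H;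
  hit_first : forall a b X, s1 = a ++ b -> b <> [] -> reduces M a X -> ~ bad (C X) }.

Lemma hit_std bad C M s1 H s2 N : hit bad C M s1 H s2 N -> std H (length s2) N.
Proof.
  intros HH; destruct (hit_good _ _ _ _ _ _ _ HH) as [_ HG].
  now apply (HG s1 s2 H), (hit_reduces _ _ _ _ _ _ _ HH).
Qed.

Lemma hit_standard bad C M s1 H s2 N : hit bad C M s1 H s2 N -> standard M s1 H.
Proof.
  intros HH; destruct (hit_good _ _ _ _ _ _ _ HH) as [_ HG].
  now apply (HG s1 s2 H), (hit_reduces _ _ _ _ _ _ _ HH).
Qed.

Lemma hit_never bad C M s1 H s2 N :
  hit bad C M s1 H s2 N -> never_before_end bad (C M) (at_ [Body] s1).
Proof. intros []; now apply never_before_end_hole. Qed.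

(** [d] is 1 when [std] contracts the outer redex after the body, and 0 when the outer constructor
    stays. As suffixes must be in [std] with their own length, the new remainder has to be exactly
    [d] longer than the old one. *)
Lemma hit_good_extend bad C M s1 H s2 N d r N' :
  hit bad C M s1 H s2 N ->
  (forall X n, std X n N -> std (C X) (n + d) N') ->
  length r = length s2 + d ->
  reduces (C H) r N' ->
  (forall r1 r2 X, r = r1 ++ r2 -> reduces (C H) r1 X ->
     standard (C M) (at_ [Body] s1 ++ r1) X /\ std X (length r2) N') ->
  good (C M) (at_ [Body] s1 ++ r) N'.
Proof.
  intros HH HC Hr Hred Htail; apply (good_hit bad) with (H := H); try apply HH; auto.
  intros a b X -> Hb HX; destruct HH as [_ _ [_ HG] HH Hf].
  destruct (HG a (b ++ s2) X) as [Hst Hstd]; [now rewrite app_assoc | easy |].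
  split; [easy|]; split; [now apply (Hf a b)|].
  rewrite Hr; rewrite length_app in Hstd; rewrite Nat.add_assoc; now apply HC.
Qed.

Lemma hit_good_in bad C M s1 H s2 N C' P t Q :
  hit bad C M s1 H s2 N ->
  hole [Body; Body] C' -> C H = C' P -> C N = C' Q ->
  (forall X n, std X n N -> std (C X) n (C N)) ->
  (forall X n, std X n Q -> std (C' X) n (C' Q)) ->
  (forall t X, standard P t X ->
     standard (C M) (at_ [Body] s1 ++ at_ [Body; Body] t) (C' X)) ->
  good P t Q -> length t = length s2 ->
  good (C M) (at_ [Body] s1 ++ at_ [Body; Body] t) (C N).
Proof.
  intros HH HC' EH EN HC HC'std Hst [Hred HG] Ht.
  apply (hit_good_extend bad) with (H := H) (s2 := s2) (N := N) (d := 0); auto.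
  - intros; rewrite Nat.add_0_r; auto.
  - now rewrite length_at, Ht, Nat.add_0_r.
  - rewrite EH, EN; now apply hole_reduces.
  - intros r1 r2 X E HX; rewrite EH in HX.
    unfold at_ in E; apply map_eq_app in E as (a & b & -> & <- & <-).
    apply (hole_reduces_inv _ _ _ _ _ HC') in HX as (Y & -> & HY).
    destruct (HG a b Y eq_refl HY) as [H1 H2].
    rewrite length_map, EN; split; [now apply Hst | auto].
Qed.

(** The redex is contracted as soon as it appears, and the remainder [t] makes up for that one
    step. *)
Lemma hit_good_contract bad C M s1 H s2 N P t N' d :
  hit bad C M s1 H s2 N ->
  contract [] (C H) = Some P ->
  (forall X n, std X n N -> std (C X) (n + d) N') ->
  standard (C M) (at_ [Body] s1) (C H) ->
  (forall t X, standard P t X -> standard (C M) (at_ [Body] s1 ++ [] :: t) X) ->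
  good P t N' -> S (length t) = length s2 + d ->
  good (C M) (at_ [Body] s1 ++ [] :: t) N'.
Proof.
  intros HH E HC Hst0 Hst [Hred HG] Ht.
  apply (hit_good_extend bad) with (H := H) (s2 := s2) (N := N) (d := d); auto.
  - econstructor; eauto.
  - intros [|p r1] r2 X Er HX; simpl in Er.
    + subst r2; inversion HX; subst; rewrite app_nil_r; split; [easy|].
      simpl; rewrite Ht; apply HC; eapply hit_std; eauto.
    + injection Er as <- ->; inversion HX as [|? ? P' ? ? E' HX']; subst.
      rewrite E in E'; injection E' as <-; destruct (HG r1 r2 X eq_refl HX'); auto.
Qed.

(** * Realisation, by the shape of the [std] derivation *)

Definition realizable (n : nat) (M : term) : Prop :=
  forall N, std M n N -> typable M -> exists s, length s = n /\ good M s N.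

Lemma args_realizable Ms b Ns :
  stds Ms b Ns ->
  (forall A k, In A Ms -> k <= b -> realizable k A) ->
  (forall A, In A Ms -> typable A) ->
  exists s, length s = b /\ good_args Ms s Ns.
Proof.
  induction 1 as [|M n N Ms k Ns HM HMs IH]; intros HR HT.
  - exists []; split; [easy|]; split; [|split].
    + intros; constructor.
    + constructor.
    + intros s1 s2 E; symmetry in E; apply app_eq_nil in E as [-> ->].
      exists []; repeat constructor.
  - destruct IH as (s & <- & Hs);
      [intros; apply HR; simpl; auto; lia | intros; apply HT; now right |].
    destruct (HR M n (or_introl eq_refl) ltac:(lia) N HM (HT M (or_introl eq_refl)))
      as (t & <- & Ht).
    eexists; split; [|apply good_args_cons; eauto].
    now rewrite length_app, length_at.
Qed.

Lemma spine_inv M n N :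
  spine M n N ->
  exists H h H' Ms b Ns, M = apps H Ms /\ N = apps H' Ns /\ stds Ms b Ns /\ n = h + b /\
    ((exists x, H = Var x /\ H' = Var x /\ h = 0) \/
     (exists P Q, H = Lam P /\ H' = Lam Q /\ std P h Q) \/
     (exists P Q, H = Mu P /\ H' = Mu Q /\ std P h Q)).
Proof.
  revert n N; induction M as [x|M _|M _|a M _|M IHM N _]; intros n X HX;
    inversion HX; subst.
  - exists (Var x), 0, (Var x), [], 0, []; repeat split; [constructor | eauto].
  - eexists (Lam M), n, _, [], 0, []; repeat split; [constructor | lia | eauto 7].
  - eexists (Mu M), n, _, [], 0, []; repeat split; [constructor | lia | eauto 7].
  - match goal with HS : spine M _ _ |- _ =>
      destruct (IHM _ _ HS) as (H & h & H' & Ms & b & Ns & -> & -> & Hs & -> & HH) end.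
    exists H, h, H', (Ms ++ [N]), (b + k), (Ns ++ [N']).
    rewrite !apps_app; repeat split; [|lia | exact HH].
    match goal with HN : std N _ _ |- _ => clear - Hs HN end.
    induction Hs; simpl.
    + rewrite <- (Nat.add_0_r k) at 1; constructor; [easy | constructor].
    + rewrite <- Nat.add_assoc; now constructor.
Qed.

Lemma comp_apps_head H Ms : comp H <= comp (apps H Ms).
Proof.
  revert H; induction Ms as [|A Ms IH]; intros H; simpl; [easy|].
  specialize (IH (App H A)); simpl in IH; lia.
Qed.

Lemma comp_apps_arg A H Ms : In A Ms -> comp A < comp (apps H Ms).
Proof.
  revert H; induction Ms as [|B Ms IH]; intros H; simpl; [easy|]; intros [-> | HA].
  - pose proof (comp_apps_head (App H A) Ms); pose proof (comp_pos H); simpl in *; lia.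
  - now apply IH.
Qed.

Lemma typable_apps H Ms :
  typable (apps H Ms) -> typable H /\ forall A, In A Ms -> typable A.
Proof.
  revert H; induction Ms as [|B Ms IH]; intros H HT; simpl in *; [easy|].
  apply IH in HT as [HT HA]; apply typable_app in HT as [HT HB].
  split; [easy | intros A [<- | HA']; auto].
Qed.

Lemma contract_theta P : contract [] (Mu (Name 0 (mren S P))) = Some P.
Proof. simpl; now rewrite mocc_0_mren_S, mlower_S. Qed.

Lemma theta_redex_inv M : theta_redex (Mu M) -> exists P, M = Name 0 (mren S P).
Proof.
  intros (P & E & H); injection E as ->; exists (mlower P); now rewrite mren_S_mlower.
Qed.

Lemma hole_typable q C M s N :
  hole q C -> reduces M s N -> typable (C M) -> typable (C N).
Proof. intros HC Hr; eapply reduces_typable, hole_reduces; eauto. Qed.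

(** The induction hypothesis for the lexicographic order on length and size. *)
Definition realizable_below (n c : nat) : Prop :=
  forall n' M, n' <= n -> (n' = n -> comp M < c) -> realizable n' M.

Lemma std_rho_mlower n c P k V :
  realizable_below n c -> std (mren S P) k (Mu V) -> typable (mren S P) -> k < n ->
  std P k (Mu (rho_subst V 0)).
Proof.
  intros IH H HT Hk.
  destruct (IH k (mren S P) ltac:(lia) ltac:(lia) _ H HT) as (s & _ & Hs).
  rewrite <- mlower_mu_rho.
  - rewrite <- (mlower_S P); now apply std_mren.
  - apply good_reduces in Hs; apply (reduces_mocc_0 _ _ _ 0) in Hs; [easy|].
    apply mocc_0_mren_S.
Qed.

Lemma hit_theta_contract M s1 P s2 N d t N' :
  hit theta_redex Mu M s1 (Name 0 (mren S P)) s2 N ->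
  (forall X n, std X n N -> std (Mu X) (n + d) N') ->
  good P t N' -> S (length t) = length s2 + d ->
  good (Mu M) (at_ [Body] s1 ++ [] :: t) N'.
Proof.
  intros HH HC HG Ht.
  pose proof (hit_standard _ _ _ _ _ _ _ HH) as Hst.
  pose proof (hit_never _ _ _ _ _ _ _ HH) as Hnev.
  apply (hit_good_contract _ _ _ _ _ _ _ P t _ d HH); auto.
  - apply contract_theta.
  (* The prefix that stops exactly at the theta-redex is standard by the clause that continues below
     it, with nothing done there. *)
  - rewrite <- (app_nil_r (at_ _ _)).
    apply (standard_mu_theta_in M s1 (mren S P) [] (mren S P)); auto.
    + apply mocc_0_mren_S.
    + constructor.
  - intros t' X HX; apply standard_mu_theta with (P := mren S P); auto.
    + apply mocc_0_mren_S.
    + now rewrite mlower_S.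
Qed.

Lemma hit_rho_contract a M s1 P s2 N d t N' :
  hit rho_redex (Name a) M s1 (Mu P) s2 N ->
  (forall X n, std X n N -> std (Name a X) (n + d) N') ->
  good (rho_subst P a) t N' -> S (length t) = length s2 + d ->
  good (Name a M) (at_ [Body] s1 ++ [] :: t) N'.
Proof.
  intros HH HC HG Ht.
  pose proof (hit_standard _ _ _ _ _ _ _ HH) as Hst.
  pose proof (hit_never _ _ _ _ _ _ _ HH) as Hnev.
  apply (hit_good_contract _ _ _ _ _ _ _ (rho_subst P a) t _ d HH); auto.
  - rewrite <- (app_nil_r (at_ _ _)).
    apply (standard_name_rho_in a M s1 P [] P); auto; constructor.
  - intros t' X HX; apply standard_name_rho with (P := P); auto.
Qed.

(** If the cut does not shorten the sequence, the redex was there from the start, so that passing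
    below it decreases the size. *)
Lemma hit_start bad C M s1 H s2 N :
  hit bad C M s1 H s2 N -> length (s1 ++ s2) = length s2 -> M = H.
Proof.
  intros HH E; pose proof (hit_reduces _ _ _ _ _ _ _ HH) as Hr.
  destruct s1; [now inversion Hr | simpl in E; rewrite length_app in E; lia].
Qed.

Lemma realizable_mu n M N :
  realizable_below n (comp (Mu M)) -> std M n N -> typable (Mu M) ->
  exists s, length s = n /\ good (Mu M) s (Mu N).
Proof.
  intros IH HM HT.
  destruct (IH n M (le_n n) ltac:(simpl; lia) N HM (typable_mu _ HT)) as (s & Hn & HG).
  destruct (first_hit (fun X => theta_redex (Mu X)) M s N
              (fun X => theta_redex_dec (Mu X)) (good_reduces _ _ _ HG))
    as [Hno | (s1 & s2 & H & -> & Hr & Hbad & Hfirst)].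
  { exists (at_ [Body] s); rewrite length_at; split; [easy|].
    apply (good_never theta_redex); auto using hole_mu, standard_mu. }
  apply theta_redex_inv in Hbad as [P ->].
  assert (hit theta_redex Mu M s1 (Name 0 (mren S P)) s2 N) as HH
    by (split; auto using hole_mu, standard_mu).
  pose proof (hit_std _ _ _ _ _ _ _ HH) as HS.
  assert (typable (Mu (Name 0 (mren S P)))) as HTH
    by exact (hole_typable _ _ _ _ _ hole_mu Hr HT).
  pose proof (typable_name _ _ (typable_mu _ HTH)) as HTP.
  pose proof (hit_start _ _ _ _ _ _ _ HH) as Hs1.
  rewrite <- Hn in *; rewrite length_app in Hs1; clear Hn n.
  inversion HS as [? ? ? ? Hh | ? ? ? Hsp | | ? ? ? Q HQ | ? ? k V HV | ? ? ? Hstk]; subst.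
  - inversion Hh.
  - inversion Hsp.
  - destruct (IH (length s2) (mren S P)) with (N := Q) as (t & Ht & HGt); auto.
    + rewrite length_app; lia.
    + rewrite length_app; intros E; rewrite Hs1 by easy; simpl; lia.
    + exists (at_ [Body] s1 ++ at_ [Body; Body] t); split.
      * rewrite !length_app, !length_at; lia.
      * apply (hit_good_in _ _ _ _ _ _ _ (fun X => Mu (Name 0 X)) (mren S P) t Q HH); auto.
        -- exact (hole_app _ _ _ _ hole_mu (hole_name 0)).
        -- intros; apply standard_mu_theta_in with (P := mren S P); auto.
           ++ eapply hit_standard; eauto.
           ++ apply mocc_0_mren_S.
           ++ eapply hit_never; eauto.
  (* The remainder ends with rho on [[0]mu b.V], which [standard] does not allow while this
     theta-redex is kept. Contracting theta now leads to the same term in the same number of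
     steps. *)
  - rewrite length_app in IH.
    pose proof (std_rho_mlower _ _ _ _ _ IH HV HTP ltac:(lia)) as HP.
    destruct (IH k P) with (N := Mu (rho_subst V 0)) as (t & Ht & HGt); auto; try lia.
    + eapply reduces_typable; [|exact HTH].
      econstructor; [apply contract_theta | constructor].
    + exists (at_ [Body] s1 ++ [] :: t); split.
      * rewrite !length_app, length_at; simpl; lia.
      * apply (hit_theta_contract _ _ _ _ _ 0 _ _ HH); auto; try lia.
        intros; rewrite Nat.add_0_r; auto.
  - inversion Hstk.
Qed.

Lemma realizable_theta n M N :
  realizable_below (S n) (comp (Mu M)) -> std M n (Name 0 (mren S N)) ->
  typable (Mu M) -> exists s, length s = S n /\ good (Mu M) s N.
Proof.
  intros IH HM HT.
  destruct (IH n M ltac:(lia) ltac:(lia) _ HM (typable_mu _ HT)) as (s & Hn & HG).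
  destruct (first_hit (fun X => theta_redex (Mu X)) M s _
              (fun X => theta_redex_dec (Mu X)) (good_reduces _ _ _ HG))
    as [Hno | (s1 & s2 & H & -> & Hr & Hbad & Hfirst)].
  (* The end of the body sequence itself forms a theta-redex, so a first one exists. *)
  { exfalso; apply (Hno s [] (Name 0 (mren S N)));
      [now rewrite app_nil_r | now apply good_reduces |].
    exists (mren S N); split; [easy | apply mocc_0_mren_S]. }
  apply theta_redex_inv in Hbad as [P ->].
  assert (hit theta_redex Mu M s1 (Name 0 (mren S P)) s2 (Name 0 (mren S N))) as HH
    by (split; auto using hole_mu, standard_mu).
  pose proof (hit_std _ _ _ _ _ _ _ HH) as HS.
  assert (typable (Mu (Name 0 (mren S P)))) as HTH
    by exact (hole_typable _ _ _ _ _ hole_mu Hr HT).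
  pose proof (typable_name _ _ (typable_mu _ HTH)) as HTP.
  rewrite length_app in Hn.
  assert (std P (length s2) N) as HP.
  { inversion HS as [? ? ? ? Hh | ? ? ? Hsp | | ? ? ? Q HQ | ? ? k V HV
                     | ? ? ? Hstk]; subst.
    - inversion Hh.
    - inversion Hsp.
    - now apply std_mlower.
    (* The rho-step again gives way to theta; the outer theta-step then becomes a root contraction
       appended to the [k] steps from [P]. *)
    - apply (std_rho_mlower _ _ _ _ _ IH) in HV; [|easy | lia].
      match goal with E : rho_subst V 0 = _ |- _ => rewrite E in HV end.
      apply (std_simple _ _ _ _ HV), ctx_root; constructor.
    - inversion Hstk. }
  destruct (IH (length s2) P) with (N := N) as (t & Ht & HGt); auto; try lia.
  - eapply reduces_typable; [|exact HTH].
    econstructor; [apply contract_theta | constructor].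
  - exists (at_ [Body] s1 ++ [] :: t); split.
    + rewrite !length_app, length_at; simpl; lia.
    + apply (hit_theta_contract _ _ _ _ _ 1 _ _ HH); auto; try lia.
      intros; rewrite Nat.add_1_r; auto.
Qed.

Lemma realizable_name a n M N :
  realizable_below n (comp (Name a M)) -> std M n N -> typable (Name a M) ->
  exists s, length s = n /\ good (Name a M) s (Name a N).
Proof.
  intros IH HM HT.
  destruct (IH n M (le_n n) ltac:(simpl; lia) N HM (typable_name _ _ HT)) as (s & Hn & HG).
  destruct (first_hit (fun X => rho_redex (Name a X)) M s N
              (fun X => rho_redex_dec (Name a X)) (good_reduces _ _ _ HG))
    as [Hno | (s1 & s2 & H & -> & Hr & (b & P & E) & Hfirst)].
  { exists (at_ [Body] s); rewrite length_at; split; [easy|].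
    apply (good_never rho_redex (Name a)); auto using hole_name, standard_name. }
  injection E as <- ->.
  assert (hit rho_redex (Name a) M s1 (Mu P) s2 N) as HH
    by (split; auto using hole_name, standard_name).
  pose proof (hit_std _ _ _ _ _ _ _ HH) as HS.
  assert (typable (Name a (Mu P))) as HTH
    by exact (hole_typable _ _ _ _ _ (hole_name a) Hr HT).
  pose proof (typable_mu _ (typable_name _ _ HTH)) as HTP.
  pose proof (hit_start _ _ _ _ _ _ _ HH) as Hs1.
  rewrite <- Hn in *; rewrite length_app in Hs1, IH; clear Hn n.
  inversion HS as [? ? ? ? Hh | ? ? ? Hsp | ? k Q HQ | | | ? ? ? Hstk]; subst.
  - inversion Hh.
  - inversion Hsp as [| |? ? Q HQ |]; subst.
    destruct (IH (length s2) P) with (N := Q) as (t & Ht & HGt); auto; try lia.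
    + intros E; rewrite Hs1 by easy; simpl; lia.
    + exists (at_ [Body] s1 ++ at_ [Body; Body] t); split.
      * rewrite !length_app, !length_at; lia.
      * apply (hit_good_in _ _ _ _ _ _ _ (fun X => Name a (Mu X)) P t Q HH); auto.
        -- exact (hole_app _ _ _ _ (hole_name a) hole_mu).
        -- intros; apply standard_name_rho_in with (P := P); auto.
           ++ eapply hit_standard; eauto.
           ++ eapply hit_never; eauto.
  (* Theta is exchanged for rho: both turn [[a]mu b.[b]N] into [[a]N], and rho can be performed at
     once. *)
  - assert (std (rho_subst P a) k (Name a N)) as HP.
    { apply (std_mren (fun n => match n with 0 => a | S n => n end)) in HQ.
      simpl in HQ; rewrite mren_mren in HQ; change (mren _ N) with (mren ident N) in HQ.
      now rewrite mren_ident in HQ. }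
    destruct (IH k (rho_subst P a)) with (N := Name a N) as (t & Ht & HGt); auto; try lia.
    + eapply reduces_typable; [|exact HTH].
      eapply red_cons with (p := []); [reflexivity | constructor].
    + exists (at_ [Body] s1 ++ [] :: t); split.
      * rewrite !length_app, length_at; simpl; lia.
      * apply (hit_rho_contract _ _ _ _ _ _ 0 _ _ HH); auto; try lia.
        intros; rewrite Nat.add_0_r; auto.
  - inversion Hstk.
Qed.

Lemma realizable_rho a n M V :
  realizable_below (S n) (comp (Name a M)) -> std M n (Mu V) -> typable (Name a M) ->
  exists s, length s = S n /\ good (Name a M) s (rho_subst V a).
Proof.
  intros IH HM HT.
  destruct (IH n M ltac:(lia) ltac:(lia) _ HM (typable_name _ _ HT)) as (s & Hn & HG).
  destruct (first_hit (fun X => rho_redex (Name a X)) M s _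
              (fun X => rho_redex_dec (Name a X)) (good_reduces _ _ _ HG))
    as [Hno | (s1 & s2 & H & -> & Hr & (b & P & E) & Hfirst)].
  { exfalso; apply (Hno s [] (Mu V));
      [now rewrite app_nil_r | now apply good_reduces | now exists a, V]. }
  injection E as <- ->.
  assert (hit rho_redex (Name a) M s1 (Mu P) s2 (Mu V)) as HH
    by (split; auto using hole_name, standard_name).
  assert (typable (Name a (Mu P))) as HTH
    by exact (hole_typable _ _ _ _ _ (hole_name a) Hr HT).
  rewrite length_app in Hn.
  destruct (IH (length s2) (rho_subst P a)) with (N := rho_subst V a)
    as (t & Ht & HGt); auto; try lia.
  - apply std_mren, std_mu_inv; eapply hit_std; eauto.
  - eapply reduces_typable; [|exact HTH].
    eapply red_cons with (p := []); [reflexivity | constructor].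
  - exists (at_ [Body] s1 ++ [] :: t); split.
    + rewrite !length_app, length_at; simpl; lia.
    + apply (hit_rho_contract _ _ _ _ _ _ 1 _ _ HH); auto; try lia.
      intros; rewrite Nat.add_1_r; auto.
Qed.

Lemma realizable_spine n M N :
  realizable_below n (comp M) -> spine M n N -> typable M ->
  exists s, length s = n /\ good M s N.
Proof.
  intros IH HM HT.
  apply spine_inv in HM as (H & h & H' & Ms & b & Ns & -> & -> & HMs & -> & HH).
  pose proof (typable_apps _ _ HT) as [HTH HTMs].
  destruct (args_realizable Ms b Ns HMs) as (s & <- & HGs); auto.
  { intros A k HA Hk; apply IH; [lia|]; intros _; now apply comp_apps_arg. }
  pose proof (comp_apps_head H Ms).
  destruct HH as [(x & -> & -> & ->) | [(P & Q & -> & -> & HPQ) | (P & Q & -> & -> & HPQ)]].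
  - exists s; split; [easy | now apply good_var_args].
  - destruct (IH h P ltac:(lia) ltac:(simpl in *; lia) Q HPQ (typable_lam _ HTH))
      as (t & <- & HGt).
    exists (at_ (repeat Fun (length Ms) ++ [Body]) t ++ s); split.
    + now rewrite length_app, length_at.
    + apply good_spine; auto using hole_lam, standard_lam_spine.
  - destruct Ms as [|A Ms].
    + inversion HMs; subst; destruct s; [|discriminate].
      rewrite Nat.add_0_r in *; now apply realizable_mu.
    (* Under arguments a kept [Mu] is not cut at theta-redexes, so the sequence of the body is used
       as it is. *)
    + destruct (IH h P ltac:(lia) ltac:(simpl in *; lia) Q HPQ (typable_mu _ HTH))
        as (t & <- & HGt).
      exists (at_ (repeat Fun (length (A :: Ms)) ++ [Body]) t ++ s); split.
      * now rewrite length_app, length_at.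
      * apply (good_spine Mu); auto using hole_mu.
        intros; now apply standard_mu_args.
Qed.

Theorem std_realizable n M : realizable n M.
Proof.
  revert M; induction n as [n IHn] using (well_founded_induction lt_wf); intros M.
  induction M as [M IHM] using (induction_ltof1 _ comp).
  assert (realizable_below n (comp M)) as IH.
  { intros n' M' Hn Hc; destruct (Nat.eq_dec n' n) as [->|].
    - apply IHM, Hc; reflexivity.
    - apply IHn; lia. }
  intros N HS HT.
  inversion HS as [? M' m ? Hh Hm | ? ? ? Hsp | M1 m P HP | a M1 ? N1 HN1
                  | a M1 m V HV | ? ? ? Hst]; subst.
  - destruct (hstep_inv _ _ Hh) as (Ms & E & Hst).
    destruct (IHn m ltac:(lia) M' N Hm) as (s & <- & HG).
    { eapply reduces_typable; [|exact HT]; econstructor; [exact E | constructor]. }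
    exists (repeat Fun (length Ms) :: s); split; [easy|].
    eapply good_head; eauto.
  - now apply realizable_spine.
  - now apply realizable_theta.
  - now apply realizable_name.
  - now apply realizable_rho.
  - now apply stuck_not_typable in Hst.
Qed.

(** * Appending a step *)

Lemma std_lmI M n N : std M n N -> typable M -> lambda_mu_I M -> lambda_mu_I N.
Proof.
  intros H HT HM; destruct (std_realizable n M N H HT) as (s & _ & HG).
  exact (reduces_lmI _ _ _ (good_reduces _ _ _ HG) HM).
Qed.

Definition extends (M : term) (f n : nat) (N : term) : Prop :=
  exists n', std M n' N /\ n' + 1 <= (1 + max f 2) * (n + 1) /\
    (typable M -> lambda_mu_I M -> n + 1 <= n').

(** For a spine the statement includes the arguments [Ms] to its right with their reductions: a
    contraction at the head has to come before these, and their number enters its price. *)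
Lemma std_extend :
  (forall M n N, std M n N -> forall f N', ctx (root f) 0 N N' -> extends M f n N') /\
  (forall M n N, spine M n N -> forall j f N' Ms b Ns,
     ctx (root f) j N N' -> stds Ms b Ns -> length Ms = j ->
     exists n', std (apps M Ms) n' (apps N' Ns) /\
       n' + 1 <= (1 + max f 2) * (n + b + 1) /\
       (typable M -> lambda_mu_I M -> n + b + 1 <= n')).
Proof.
  apply std_spine_ind.
  - intros M M' n N Hh _ IH f N' H.
    destruct (IH f N' H) as (n' & Hn' & Hup & Hlow).
    exists (S n'); split; [eauto|]; split; [nia|].
    intros HT HM; destruct (hstep_inv _ _ Hh) as (Ms & E & _).
    enough (n + 1 <= n') by lia; apply Hlow.
    + eapply reduces_typable; [|exact HT]; econstructor; [exact E | constructor].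
    + exact (proj1 (contract_lmI _ _ _ E HM)).
  - intros M n N _ IH f N' H.
    destruct (IH 0 f N' [] 0 [] H) as (n' & Hn' & Hup & Hlow); auto using stds_nil.
    rewrite Nat.add_0_r in *; now exists n'.
  - intros M n P _ IH f N' H.
    destruct (IH f (Name 0 (mren S N'))) as (n' & Hn' & Hup & Hlow).
    { apply ctx_name, ctx_forward; [apply root_forward | exact H]. }
    exists (S n'); split; [auto|]; split; [nia|]; intros HT HM.
    apply typable_mu in HT; inversion HM; subst; specialize (Hlow HT ltac:(easy)); lia.
  - intros a M n N HS IH f N' H; inversion H as [? ? ? R | | | ? ? ? ? R | |]; subst.
    + inversion R; subst; exists (S n); split; [auto | split; [nia | lia]].
    + destruct (IH f N0 R) as (n' & Hn' & Hup & Hlow).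
      exists n'; split; [auto|]; split; [easy|]; intros HT HM.
      apply typable_name in HT; inversion HM; subst; auto.
  - intros a M n V _ IH f N' H.
    apply (ctx_backward _ (root_backward f)) in H as (V' & H & ->).
    destruct (IH f (Mu V')) as (n' & Hn' & Hup & Hlow); [now apply ctx_mu|].
    exists (S n'); split; [now apply std_rho|]; split; [nia|]; intros HT HM.
    apply typable_name in HT; inversion HM; subst; specialize (Hlow HT ltac:(easy)); lia.
  - intros M n N Hst f N' _; exists (n + 1); split; [auto | split; [nia | lia]].
  - intros x j f N' Ms b Ns H; inversion H as [? ? ? R | | | | |]; inversion R.
  - intros M n N _ IH j f N' Ms b Ns H HMs _; inversion H as [? ? ? R | ? ? ? R | | | |]; subst.
    + inversion R.
    + destruct (IH f N0 R) as (n' & Hn' & Hup & Hlow).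
      exists (n' + b); split; [apply std_spine, spine_apps; auto|].
      split; [nia|]; intros HT HM.
      apply typable_lam in HT; inversion HM; subst; specialize (Hlow HT ltac:(easy)); lia.
  - intros M n N HS IH j f N' Ms b Ns H HMs Hj; inversion H as [? ? ? R | | ? ? ? R | | |]; subst.
    (* Theta under [j] arguments: [(j + 1) * (n + 1) + b + 1] has to be bounded by
       [(1 + max (2 * j - 1) 2) * (n + b + 1)]. This follows from [j + 1 <= max (2 * j - 1) 2],
       which at [j = 1] holds thanks to the 2. *)
    + inversion R; subst.
      destruct (std_apps _ _ _ _ _ _ (std_theta _ _ _ HS) HMs) as (n' & Hn' & Hb).
      exists n'; split; [easy|]; split; [nia | lia].
    + destruct (IH f N0 R) as (n' & Hn' & Hup & Hlow).
      exists (n' + b); split; [apply std_spine, spine_apps; auto|].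
      split; [nia|]; intros HT HM.
      apply typable_mu in HT; inversion HM; subst; specialize (Hlow HT ltac:(easy)); lia.
  - intros A nA A' B nB B' HA IHA HB IHB j f N' Ms b Ns H HMs Hj.
    inversion H as [? ? ? R | | | | ? ? A'' ? R | ? ? ? B'' R]; subst.
    (* The new redex is contracted first; the reductions of the function body, of [B] and of [Ms]
       are redone inside the contractum. *)
    + inversion R; subst; inversion HA; subst.
      * match goal with HU : std ?M1 nA U |- _ =>
          destruct (std_beta_subst _ _ _ _ _ _ _ _ _ HU HB HMs) as (n' & Hn' & Hlow & Hup);
          exists (S n'); split;
          [apply (std_head _ (apps (beta_subst M1 B) Ms)); [apply hstep_apps; constructor | easy]|]
        end.
        split; [nia|]; intros HT HM.
        apply typable_app in HT as [HT _]; inversion HM; subst.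
        (* The reduct [Lam U] is again a lambda-mu-I-term, so 0 occurs in [U] and the steps of [B]
           survive in at least one copy. *)
        pose proof (std_lmI _ _ _ (std_spine _ _ _ HA) HT ltac:(easy)) as HI.
        inversion HI; subst; nia.
      * match goal with HU : std ?M1 nA U |- _ =>
          destruct (std_rsub _ _ _ _ _ _ HU HB) as (n' & Hn' & Hb);
          exists (S (n' + b)); split;
          [apply (std_head _ (apps (Mu (rsub 0 (mren S B) M1)) Ms));
            [apply hstep_apps; constructor | apply std_spine, spine_apps; auto]|]
        end.
        split; [nia|]; intros HT HM.
        apply typable_app in HT as [HT _]; inversion HM; subst.
        pose proof (std_lmI _ _ _ (std_spine _ _ _ HA) HT ltac:(easy)) as HI.
        inversion HI; subst; nia.
    + destruct (IHA (S (length Ms)) f A'' (B :: Ms) (nB + b) (B' :: Ns)) as (n' & Hn' & Hup & Hlow);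
        auto using stds_cons.
      exists n'; split; [easy|]; split; [now rewrite <- (Nat.add_assoc nA nB b) |]; intros HT HM.
      apply typable_app in HT as [HT _]; inversion HM; subst.
      rewrite <- (Nat.add_assoc nA nB b); auto.
    + destruct (IHB f B'' R) as (n' & Hn' & Hup & Hlow).
      exists (nA + n' + b); split; [apply std_spine, spine_apps; auto|].
      split; [nia|]; intros HT HM.
      apply typable_app in HT as [_ HT]; inversion HM; subst.
      specialize (Hlow HT ltac:(easy)); lia.
Qed.

(** * Weights in context, and the conclusion *)

(** [weight] for a subterm with [j] arguments. Beta adds [j] because the index in [root_beta] also
    counts the arguments outside the subterm. *)
Definition weight_in (j : nat) (p : pos) (M : term) : nat :=
  match subterm p M with
  | Some (App (Mu P) _) => mocc 0 P
  | Some (App (Lam _) _) => 2 * comp M - 2 + j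
  | Some (Name _ (Mu _)) => 1
  | Some (Mu (Name 0 _)) =>
      2 * fold_left (fun n d => match d with Fun => S n | _ => 0 end) p j - 1
  | _ => 0
  end.

Lemma weight_in_0 p M : weight_in 0 p M = weight p M.
Proof.
  unfold weight_in, weight, nargs.
  destruct (subterm p M) as [[| | | |[]]|]; auto.
Qed.

Lemma contract_ctx p M M' :
  contract p M = Some M' ->
  forall j, exists f, f <= weight_in j p M /\ ctx (root f) j M M'.
Proof.
  revert M M'; induction p as [|d p IH]; intros M M' H j.
  - apply contract_root_cases in H
      as [(U & Q & -> & ->) | [(U & Q & -> & ->) | [(a & V & -> & ->) | ->]]];
      (eexists; split; [|apply ctx_root; constructor]); unfold weight_in; simpl; try lia.
  - destruct d, M as [x|M|M|a M|M1 M2]; simpl in H; try discriminate H;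
      match type of H with option_map _ (contract p ?M) = _ =>
        destruct (contract p M) as [M''|] eqn:E; [|discriminate H] end;
      injection H as <-;
      [ destruct (IH _ _ E 0) as (f & Hf & Hc) | destruct (IH _ _ E 0) as (f & Hf & Hc)
      | destruct (IH _ _ E 0) as (f & Hf & Hc) | destruct (IH _ _ E (S j)) as (f & Hf & Hc)
      | destruct (IH _ _ E 0) as (f & Hf & Hc) ];
      (exists f; split; [|auto using ctx]); (etransitivity; [exact Hf|]);
      unfold weight_in; simpl; destruct (subterm p _) as [[| |[| | |[]|]|? []|[]]|]; simpl; try lia.
    (* The redex lies in function position: taking in one argument lowers the count from [S j] to
       [j], but raises [2 * comp] by at least 2. *)
    + pose proof (comp_pos M1); pose proof (comp_pos M2); lia.
Qed.

(** Starting from an arbitrary [std M0 n M] lets the steps of [s] be appended from left to right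
    while the factors of [measure] accumulate on [n + 1]. *)
Lemma reduces_extend M s N M0 n :
  reduces M s N -> std M0 n M ->
  exists n', std M0 n' N /\ n' + 1 <= (n + 1) * measure M s /\
    (typable M0 -> lambda_mu_I M0 -> n + length s <= n').
Proof.
  intros H; revert n; induction H as [M|M p M' s N E H IH]; intros n HS; cbn [measure length].
  - exists n; split; [easy | lia].
  - destruct (contract_ctx p M M' E 0) as (f & Hf & Hc); rewrite weight_in_0 in Hf.
    destruct (proj1 std_extend _ _ _ HS f M' Hc) as (m & Hm & Hup & Hlow).
    destruct (IH m Hm) as (n' & Hn' & Hup' & Hlow'); rewrite E.
    exists n'; split; [easy|]; split.
    + etransitivity; [exact Hup'|].
      rewrite Nat.mul_assoc; apply Nat.mul_le_mono_r.
      etransitivity; [exact Hup|]. rewrite Nat.mul_comm; apply Nat.mul_le_mono_l; lia.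
    + intros HT HM; specialize (Hlow HT HM); specialize (Hlow' HT HM); lia.
Qed.

Theorem theorem3p22 (M N : term) (s : list pos)
    (M_typable : typable M) (M_red_N : reduces M s N) :
  exists st : list pos,
    reduces M st N /\
    standard M st N /\
    length st <= measure M s /\
    (lambda_mu_I M -> length s <= length st).
Proof.
  destruct (reduces_extend M s N M 0 M_red_N (std_refl M)) as (n & Hn & Hup & Hlow).
  destruct (std_realizable n M N Hn M_typable) as (st & <- & HG).
  exists st; split; [now apply good_reduces | split; [now apply good_standard | split]].
  - lia.
  - intros HM; now apply Hlow.
Qed.
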